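(* Let $m,k\in\mathbb{N}$ (so $m,k\ge 1$) and let $l\ge 0$ be an integer with $\gcd(k,l)=1$. On the torus $\mathbb{T}^2=\mathbb{R}^2/(2\pi\mathbb{Z})^2$ consider the family of vector fields $$Y_\epsilon:\quad \dot x=\sin\big(m(ly-kx)\big),\qquad \dot y=\epsilon,$$ with $\epsilon\ge 0$. For $i=1,\dots,m$ let $C_-^i=\{(x,y)\in\mathbb{T}^2:\ ly-kx\equiv 2\pi(i-1)/m \pmod{2\pi}\}$ and $C_+^i=\{(x,y)\in\mathbb{T}^2:\ ly-kx\equiv (2\pi(i-1)+\pi)/m \pmod{2\pi}\}$. These are $2m$ disjoint simple closed curves of singularities of $Y_0$, each wrapping $k$ times vertically and $l$ times horizontally around $\mathbb{T}^2$; the $C_-^i$ consist of normally attracting singularities and the $C_+^i$ of normally repelling singularities of $Y_0$. Then there exist $\epsilon_0>0$ and tubular neighborhoods $\mathcal{U}_\pm^i$ of $C_\pm^i$ in $\mathbb{T}^2$ ($i=1,\dots,m$), independent of $\epsilon$, such that for every $\epsilon\in\,]0,\epsilon_0]$ the vector field $Y_\epsilon$ has exactly one limit cycle $\mathcal{O}_\pm^i$ in $\mathcal{U}_\pm^i$. Each $\mathcal{O}_-^i$ is a hyperbolically attracting non-canard limit cycle and each $\mathcal{O}_+^i$ is a hyperbolically repelling canard limit cycle; each $\mathcal{O}_\pm^i$ is a $(k,l)$-torus knot (it winds $k$ times vertically and $l$ times horizontally around $\mathbb{T}^2$), and $\mathcal{O}_\pm^i\to C_\pm^i$ in the Hausdorff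 sense as $\epsilon\to 0$. Moreover, for fixed $\epsilon\in\,]0,\epsilon_0]$ and any $\tau\in\mathbb{T}^2$ not lying on any of the cycles $\mathcal{O}_\pm^i$, the $\alpha$-limit set $\alpha(\tau)$ is one of the repelling cycles $\mathcal{O}_+^1,\dots,\mathcal{O}_+^m$ and the $\omega$-limit set $\omega(\tau)$ is one of the attracting cycles $\mathcal{O}_-^1,\dots,\mathcal{O}_-^m$.
   Context: Points of $\mathbb{T}^2$ are written $(x,y)$ with $x,y\in[0,2\pi[$ and opposite sides identified; ''vertically'' refers to the $y$-direction and ''horizontally'' to the $x$-direction: a closed curve winds $k$ times vertically and $l$ times horizontally if it crosses the horizontal circle $[0,2\pi[\times\{0\}$ exactly $k$ times and the vertical circle $\{0\}\times[0,2\pi[$ exactly $l$ times (in the same homotopy class as the curves $C^i_\pm$); such a simple closed curve is called a $(k,l)$-torus knot. A limit cycle of $Y_\epsilon$ is called a canard limit cycle if it contains a part passing near normally repelling portions of the critical curve (the set of singularities of $Y_0$), and non-canard otherwise. A limit cycle is hyperbolic if the derivative of its Poincaré return map differs from $1$ in absolute value. *)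

(* Defs.v *)
From Stdlib Require Import Reals Lra ZArith ClassicalEpsilon.
From Coquelicot Require Import Coquelicot.
Open Scope R_scope.

(* Points of the torus T^2 = R^2/(2 pi Z)^2 are represented by their lifts
   in R*R; a subset of T^2 is a predicate on R*R (lattice invariance is
   ensured by the definitions below / by [teq]). *)
Definition pt := (R * R)%type.

Definition teq (p q : pt) : Prop :=
  exists a b : Z, fst p - fst q = 2 * PI * IZR a /\ snd p - snd q = 2 * PI * IZR b.

Definition dist2 (p q : pt) : R :=
  sqrt ((fst p - fst q) ^ 2 + (snd p - snd q) ^ 2).

Definition same_set (A B : pt -> Prop) : Prop := forall p, A p <-> B p.
Definition subset (A B : pt -> Prop) : Prop := forall p, A p -> B p.
Definition open_set (V : pt -> Prop) : Prop :=
  forall p, V p -> exists r, 0 < r /\ forall q, dist2 p q < r -> V q.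

Definition theta (m k l : nat) (p : pt) : R :=
  INR m * (INR l * snd p - INR k * fst p).
Definition Yx (m k l : nat) (p : pt) : R := sin (theta m k l p).
Definition Yy (eps : R) (p : pt) : R := eps.

Definition is_solution (m k l : nat) (eps : R) (s : R -> pt) : Prop :=
  forall t, is_derive (fun u => fst (s u)) t (Yx m k l (s t)) /\
            is_derive (fun u => snd (s u)) t (Yy eps (s t)).

(* the flow: the (unique, global) solution through p at time 0 *)
Definition flow (m k l : nat) (eps : R) (p : pt) : R -> pt :=
  epsilon (inhabits (fun _ : R => p))
          (fun s => is_solution m k l eps s /\ s 0 = p).

Definition orbit (m k l : nat) (eps : R) (p : pt) : pt -> Prop :=
  fun q => exists t, teq q (flow m k l eps p t).

Definition min_period (m k l : nat) (eps : R) (p : pt) (T : R) : Prop :=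
  0 < T /\ teq (flow m k l eps p T) p /\
  (forall t, 0 < t < T -> ~ teq (flow m k l eps p t) p).

Definition periodic_orbit (m k l : nat) (eps : R) (O : pt -> Prop) : Prop :=
  exists p T, 0 < T /\ teq (flow m k l eps p T) p /\
    (exists t, ~ teq (flow m k l eps p t) p) /\
    same_set O (orbit m k l eps p).

Definition limit_cycle (m k l : nat) (eps : R) (O : pt -> Prop) : Prop :=
  periodic_orbit m k l eps O /\
  exists V, open_set V /\ subset O V /\
    forall O', periodic_orbit m k l eps O' -> subset O' V -> same_set O' O.

(* Poincare return map of the periodic orbit through p (minimal period T)
   on the horizontal transversal section {y = snd p} (transversal since
   y' = eps > 0; the return time to this section near p is T), in the
   coordinate x, with the lattice shift of the orbit subtracted. *)
Definition poincare (m k l : nat) (eps : R) (p : pt) (T : R) (x : R) : R :=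
  fst (flow m k l eps (x, snd p) T) - (fst (flow m k l eps p T) - fst p).

Definition hyp_attracting (m k l : nat) (eps : R) (O : pt -> Prop) : Prop :=
  exists p T d, O p /\ min_period m k l eps p T /\
    is_derive (poincare m k l eps p T) (fst p) d /\ Rabs d < 1.

Definition hyp_repelling (m k l : nat) (eps : R) (O : pt -> Prop) : Prop :=
  exists p T d, O p /\ min_period m k l eps p T /\
    is_derive (poincare m k l eps p T) (fst p) d /\ 1 < Rabs d.

(* critical curve data of Y_0: singular points and the normal eigenvalue
   (the nonzero eigenvalue of the Jacobian of Y_0 at a point of the curve
   of singularities = the trace of the Jacobian, the other one being 0). *)
Definition singular0 (m k l : nat) (p : pt) : Prop :=
  Yx m k l p = 0 /\ Yy 0 p = 0.
Definition normal_eig (m k l : nat) (p : pt) : R :=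
  Derive (fun x => Yx m k l (x, snd p)) (fst p) +
  Derive (fun y => Yy 0 (fst p, y)) (snd p).
Definition normally_repelling (m k l : nat) (p : pt) : Prop :=
  singular0 m k l p /\ 0 < normal_eig m k l p.
Definition normally_attracting (m k l : nat) (p : pt) : Prop :=
  singular0 m k l p /\ normal_eig m k l p < 0.

(* the curves C^i_- (b = false) and C^i_+ (b = true), i = 1..m *)
Definition level (m : nat) (b : bool) (i : nat) : R :=
  if b then (2 * PI * (INR i - 1) + PI) / INR m
  else 2 * PI * (INR i - 1) / INR m.
Definition Ccurve (m k l : nat) (b : bool) (i : nat) (p : pt) : Prop :=
  exists z : Z, INR l * snd p - INR k * fst p = level m b i + 2 * PI * IZR z.

(* tubular neighbourhood of C^i_b: an annular band around it
   (0 < delta < PI guarantees it is an annulus with core C^i_b) *)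
Definition tubular_nbhd (m k l : nat) (b : bool) (i : nat) (U : pt -> Prop) : Prop :=
  exists delta, 0 < delta < PI /\
    same_set U (fun p => exists z : Z,
      Rabs (INR l * snd p - INR k * fst p - level m b i - 2 * PI * IZR z) < delta).

(* (k,l)-torus knot: a simple closed curve on T^2 in the homotopy class of
   the curves C (k times vertically, l times horizontally). *)
Definition torus_knot (k l : nat) (S : pt -> Prop) : Prop :=
  exists g : R -> pt, (forall s, continuity_pt (fun u => fst (g u)) s /\
                                 continuity_pt (fun u => snd (g u)) s) /\
    (forall s, g (s + 1) = (fst (g s) + 2 * PI * INR l, snd (g s) + 2 * PI * INR k)) /\
    (forall s1 s2, 0 <= s1 -> s1 < s2 -> s2 < 1 -> ~ teq (g s1) (g s2)) /\
    same_set S (fun q => exists s, teq q (g s)).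

Definition near (A : pt -> Prop) (delta : R) (p : pt) : Prop :=
  exists q, A q /\ dist2 p q < delta.

Definition hausdorff_conv (A : R -> pt -> Prop) (C : pt -> Prop) : Prop :=
  forall delta, 0 < delta -> exists e1, 0 < e1 /\ forall eps, 0 < eps <= e1 ->
    (forall p, A eps p -> near C delta p) /\ (forall q, C q -> near (A eps) delta q).

Definition canard (m k l : nat) (O : R -> pt -> Prop) : Prop :=
  exists L, 0 < L /\ forall delta, 0 < delta -> exists e1, 0 < e1 /\
    forall eps, 0 < eps <= e1 ->
      exists p t1 t2, O eps p /\ t1 <= t2 /\
        L <= dist2 (flow m k l eps p t1) (flow m k l eps p t2) /\
        forall t, t1 <= t -> t <= t2 ->
          near (normally_repelling m k l) delta (flow m k l eps p t).

Definition omega_limit (m k l : nat) (eps : R) (p : pt) : pt -> Prop :=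
  fun q => forall delta T, 0 < delta -> exists t, T <= t /\
    near (teq q) delta (flow m k l eps p t).
Definition alpha_limit (m k l : nat) (eps : R) (p : pt) : pt -> Prop :=
  fun q => forall delta T, 0 < delta -> exists t, t <= T /\
    near (teq q) delta (flow m k l eps p t).

(* Main.v *)
(* In the coordinate [u = l y - k x] the system decouples: [theta = m u] satisfies
   [theta' = m k (sin a - sin theta)] with [sin a = l eps / k], while [y' = eps]. The equilibria
   [theta = a] (attracting) and [theta = PI - a] (repelling) modulo [2 PI] are exactly the
   closed orbits, which are lines of slope [k / l] on the torus. The phase equation is solved
   explicitly, which shows that every other orbit spirals from a repelling line to an
   attracting one; the multipliers over the period [T] are [exp (-+ m k cos a T)]. *)

Require Import Defs.
From Stdlib Require Import Reals ZArith Lra Lia ClassicalEpsilon.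
From Coquelicot Require Import Coquelicot.
Open Scope R_scope.

(** Because [flow] is obtained by choice, nothing can be said about it before a global solution is
    exhibited and shown to be unique. The explicit solution supplies existence for all times, and a
    Gronwall estimate supplies uniqueness. Uniqueness is needed for the scalar phase alone: [y] is
    affine in time, and [u] and [y] together determine [x] since [k >= 1].

    No slow manifold theory enters. The cycles are exact lines, so every statement about small [eps]
    reduces to the smallness of the angle [a].

    The remaining difficulty is the lattice. Points are lifts, [u] is meaningful only modulo [2 PI],
    and a level of [u] consists of infinitely many parallel lines in the plane. Coprimality of [k]
    and [l] yields a lattice vector that raises [u] by exactly [2 PI], so that these lines project
    to one closed curve of the torus. *)

Ltac as_real := match goal with |- ?u = ?v => change (@eq R u v) end.

(** * Trigonometric preliminaries *)

Lemma nearest_integer (x : R) : exists n : Z, -1/2 <= x - IZR n < 1/2.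
Proof.
exists (up (x - 1/2)).
destruct (archimed (x - 1/2)); lra.
Qed.

Lemma cos_2PI_shift (x : R) (n : Z) : cos (x + 2 * PI * IZR n) = cos x.
Proof.
assert (H : forall j : nat, cos (x + 2 * PI * INR j) = cos x /\ cos (x - 2 * PI * INR j) = cos x).
{ intros j; split.
  - rewrite <- (cos_period x j). f_equal; ring.
  - rewrite <- (cos_period (x - 2 * PI * INR j) j). f_equal; ring. }
destruct (Z_le_gt_dec 0 n) as [Hn|Hn].
- rewrite <- (Z2Nat.id n), <- INR_IZR_INZ by lia. apply H.
- rewrite <- (proj2 (H (Z.to_nat (- n)))), INR_IZR_INZ, Z2Nat.id, opp_IZR by lia.
  f_equal; ring.
Qed.

Lemma sin_2PI_shift (x : R) (n : Z) : sin (x + 2 * PI * IZR n) = sin x.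
Proof.
rewrite <- !cos_shift, <- (cos_2PI_shift (PI / 2 - x) (- n)), opp_IZR.
f_equal; ring.
Qed.

Lemma sin_eq_cases (x y : R) :
  sin x = sin y -> exists n : Z, x = y + 2 * PI * IZR n \/ x = PI - y + 2 * PI * IZR n.
Proof.
intros H.
assert (H2 : cos ((x + y) / 2) * sin ((x - y) / 2) = 0).
{ pose proof (form4 x y) as E. nra. }
destruct (Rmult_integral _ _ H2) as [H3|H3].
- destruct (cos_eq_0_0 _ H3) as [n Hn]. exists n; right; lra.
- destruct (sin_eq_0_0 _ H3) as [n Hn]. exists n; left; lra.
Qed.

Lemma sin_lipschitz (x y : R) : Rabs (sin x - sin y) <= Rabs (x - y).
Proof.
destruct (MVT_gen sin x y cos) as [c [_ Hc]].
- intros; apply is_derive_sin.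
- intros; apply continuity_sin.
- rewrite Rabs_minus_sym, (Rabs_minus_sym x), Hc, Rabs_mult.
  pose proof (COS_bound c). assert (Rabs (cos c) <= 1) by (apply Rabs_le; lra).
  pose proof (Rabs_pos (y - x)). nra.
Qed.

Lemma atan_lipschitz (x y : R) : Rabs (atan x - atan y) <= Rabs (x - y).
Proof.
destruct (MVT_gen atan x y (fun x => / (1 + x²))) as [c [_ Hc]].
- intros; apply is_derive_atan.
- intros; apply derivable_continuous_pt, derivable_pt_atan.
- rewrite Rabs_minus_sym, (Rabs_minus_sym x), Hc, Rabs_mult.
  assert (0 < / (1 + c²) <= 1).
  { pose proof (Rle_0_sqr c). split. apply Rinv_0_lt_compat; lra. rewrite <- Rinv_1. apply Rinv_le_contravar; lra. }
  rewrite (Rabs_pos_eq (/ _)) by lra.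
  pose proof (Rabs_pos (y - x)). nra.
Qed.

(** * The scalar phase equation *)

Definition phase_sol (M a : R) (f : R -> R) : Prop :=
  forall t, is_derive f t (M * (sin a - sin (f t))).

(* The reflection [x -> PI - x] reverses time, so every fact about attraction
   yields the corresponding one about repulsion. *)
Lemma phase_sol_reverse (M a : R) (f : R -> R) :
  phase_sol M a f -> phase_sol M a (fun t => PI - f (- t)).
Proof.
intros Hf t.
replace (sin (PI - f (- t))) with (sin (f (- t))) by now rewrite sin_PI_x.
replace (M * _) with (0 - (-1) * (M * (sin a - sin (f (- t))))) by ring.
apply (is_derive_minus (fun _ => PI) (fun t => f (- t))).
- apply (@is_derive_const R_AbsRing R_NormedModule).
- apply (is_derive_comp f (fun t => - t)).
  + apply Hf.
  + auto_derive; [trivial | ring].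
Qed.

(** Gronwall: [sin] is 1-Lipschitz, so [(f - g)^2 exp (- 2 M t)] has nonpositive derivative. It
    starts at 0 and is nonnegative, hence it vanishes. *)
Lemma phase_unique_forward (M a : R) (f g : R -> R) :
  0 < M -> phase_sol M a f -> phase_sol M a g -> f 0 = g 0 ->
  forall t, 0 <= t -> f t = g t.
Proof.
intros HM Hf Hg H0 t Ht.
set (h := fun t => (f t - g t) ^ 2 * exp (- (2 * M * t))).
set (dh := fun t => 2 * ((f t - g t) * - (M * (sin (f t) - sin (g t))) - M * (f t - g t) ^ 2)
   * exp (- (2 * M * t))).
assert (Hd : forall s, is_derive h s (dh s)).
{ intros s. unfold h, dh. pose proof (Hf s) as F. pose proof (Hg s) as G.
  auto_derive.
  - repeat split; eexists; eassumption.
  - rewrite (is_derive_unique (fun x : R => f x) _ _ F), (is_derive_unique (fun x : R => g x) _ _ G). ring. }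
destruct (MVT_gen h 0 t dh) as [c [_ Hc]].
- intros; apply Hd.
- intros. apply derivable_continuous_pt. eexists. apply is_derive_Reals, Hd.
- assert (Hdc : dh c <= 0).
  { unfold dh. pose proof (exp_pos (- (2 * M * c))).
    assert (- (f c - g c) * (sin (f c) - sin (g c)) <= (f c - g c) ^ 2).
    { eapply Rle_trans; [apply Rle_abs|].
      rewrite Rabs_mult, Rabs_Ropp, <- pow2_abs.
      pose proof (sin_lipschitz (f c) (g c)). pose proof (Rabs_pos (f c - g c)). nra. }
    apply Rmult_le_reg_r with (/ exp (- (2 * M * c))). now apply Rinv_0_lt_compat.
    rewrite Rmult_assoc, Rinv_r, Rmult_1_r, Rmult_0_l by lra. nra. }
  assert (Hh : h t <= 0).
  { unfold h at 2 in Hc. rewrite H0 in Hc. nra. }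
  unfold h in Hh. pose proof (exp_pos (- (2 * M * t))).
  assert ((f t - g t) ^ 2 <= 0) by nra. nra.
Qed.

Lemma phase_unique (M a : R) (f g : R -> R) :
  0 < M -> phase_sol M a f -> phase_sol M a g -> f 0 = g 0 -> forall t, f t = g t.
Proof.
intros HM Hf Hg H0 t.
destruct (Rle_dec 0 t) as [Ht|Ht].
- now apply (phase_unique_forward M a).
- assert (E : PI - f (- - t) = PI - g (- - t)).
  { apply (phase_unique_forward M a (fun t => PI - f (- t)) (fun t => PI - g (- t)));
      auto using phase_sol_reverse; [rewrite Ropp_0|]; lra. }
  rewrite Ropp_involutive in E. lra.
Qed.

Lemma phase_sol_const (M a c : R) : sin c = sin a -> phase_sol M a (fun _ => c).
Proof.
intros H t. rewrite H, Rminus_diag, Rmult_0_r. apply (@is_derive_const R_AbsRing R_NormedModule).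
Qed.

Lemma cos_pos_acute (a : R) : 0 <= a < PI / 2 -> 0 < cos a.
Proof. intros H. apply cos_gt_0; lra. Qed.

(** The rational parametrisation of the circle by the tangent of the half angle; it turns the phase
    equation into an identity between rational functions of [x]. *)
Lemma cos_sin_of_atan (x : R) :
  cos (2 * atan x) = (1 - x ^ 2) / (1 + x ^ 2) /\ sin (2 * atan x) = 2 * x / (1 + x ^ 2).
Proof.
pose proof (atan_bound x) as B.
assert (C : 0 < cos (atan x)) by (apply cos_gt_0; lra).
assert (T : sin (atan x) = x * cos (atan x)).
{ rewrite <- (tan_atan x) at 2. unfold tan. field. lra. }
pose proof (sin2_cos2 (atan x)) as S. unfold Rsqr in S. rewrite T in S.
rewrite cos_2a, sin_2a, T.
assert (D : cos (atan x) * cos (atan x) = / (1 + x ^ 2)).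
{ field_simplify_eq; nra. }
split.
- replace (_ - _) with ((1 - x ^ 2) * (cos (atan x) * cos (atan x))) by ring. now rewrite D.
- replace (_ * _) with ((2 * x) * (cos (atan x) * cos (atan x))) by ring. now rewrite D.
Qed.

(* In the coordinate [T = tan ((x + a) / 2)] the phase equation becomes the linear equation
   [T' = - M cos a (T - tan a)]; the repelling equilibria are sent to infinity. *)
Definition phase_formula (M a : R) (n : Z) (T0 t : R) : R :=
  2 * PI * IZR n - a + 2 * atan (tan a + (T0 - tan a) * exp (- (M * cos a * t))).

(** With [x] the argument of [atan], the half-angle formulas give [sin a - sin f = 2 (sin a - x cos
    a) / (1 + x^2)], which is [- 2 cos a (x - tan a) / (1 + x^2)]. *)
Lemma phase_formula_sol (M a : R) (n : Z) (T0 : R) :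
  0 <= a < PI / 2 -> phase_sol M a (phase_formula M a n T0).
Proof.
intros Ha t. pose proof (cos_pos_acute a Ha) as Ca. unfold phase_formula.
set (x := tan a + (T0 - tan a) * exp (- (M * cos a * t))).
assert (E : sin (2 * PI * IZR n - a + 2 * atan x) = 2 * x / (1 + x ^ 2) * cos a - (1 - x ^ 2) / (1 + x ^ 2) * sin a).
{ replace (_ + _) with ((2 * atan x - a) + 2 * PI * IZR n) by ring.
  rewrite sin_2PI_shift, sin_minus. destruct (cos_sin_of_atan x) as [-> ->]. reflexivity. }
rewrite E.
evar_last.
- apply (is_derive_plus (fun _ => 2 * PI * IZR n - a)).
  + apply (@is_derive_const R_AbsRing R_NormedModule).
  + apply (is_derive_scal (fun t => atan (tan a + (T0 - tan a) * exp (- (M * cos a * t))))).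
    apply (is_derive_comp atan (fun t => tan a + (T0 - tan a) * exp (- (M * cos a * t)))).
    * apply is_derive_atan.
    * auto_derive; [trivial | reflexivity].
- fold x. simpl. unfold plus, zero, scal, mult; simpl. unfold mult; simpl.
  assert (X : (T0 - tan a) * exp (- (M * cos a * t)) = x - tan a) by (unfold x; ring).
  transitivity (2 * - (M * cos a) * ((T0 - tan a) * exp (- (M * cos a * t))) / (1 + x ^ 2)).
  + rewrite Rsqr_pow2. as_real. field. nra.
  + rewrite X. unfold tan. field. split; nra.
Qed.

(** Each chart is the open interval of length [2 PI] between two consecutive repelling equilibria.
    The points left out by all charts are those equilibria. *)
Lemma phase_chart (a th : R) :
  sin th = sin a \/
  exists n T0, th = 2 * PI * IZR n - a + 2 * atan T0.
Proof.
destruct (nearest_integer ((th + a) / (2 * PI))) as [n [H1 H2]].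
pose proof PI_RGT_0 as P.
assert (E : (th + a) / (2 * PI) * (2 * PI) = th + a) by (field; lra).
destruct (Rle_lt_or_eq_dec _ _ H1) as [H3|H3].
- right. exists n, (tan ((th + a) / 2 - PI * IZR n)).
  rewrite atan_tan; [lra | split; nra].
(* The closed end of the interval of [nearest_integer] is the repelling point below the chart [n],
   which carries the index [n - 1]. *)
- left. replace th with ((PI - a) + 2 * PI * IZR (n - 1)).
  + rewrite sin_2PI_shift. now rewrite sin_PI_x.
  + rewrite minus_IZR. nra.
Qed.

Lemma phase_formula_0 (M a : R) (n : Z) (T0 : R) :
  phase_formula M a n T0 0 = 2 * PI * IZR n - a + 2 * atan T0.
Proof.
unfold phase_formula. rewrite Rmult_0_r, Ropp_0, exp_0. do 3 f_equal. ring.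
Qed.

Lemma phase_global (M a : R) (f : R -> R) :
  0 < M -> 0 <= a < PI / 2 -> phase_sol M a f ->
  (sin (f 0) = sin a /\ forall t, f t = f 0) \/
  exists n T0, forall t, f t = phase_formula M a n T0 t.
Proof.
intros HM Ha Hf.
destruct (phase_chart a (f 0)) as [H|[n [T0 H]]].
- left. split; [exact H|].
  apply (phase_unique M a); auto using phase_sol_const.
- right. exists n, T0. apply (phase_unique M a); auto using phase_formula_sol.
  now rewrite phase_formula_0.
Qed.

Lemma phase_exists (M a th : R) :
  0 <= a < PI / 2 -> exists f, phase_sol M a f /\ f 0 = th.
Proof.
intros Ha.
destruct (phase_chart a th) as [H|[n [T0 H]]].
- exists (fun _ => th). auto using phase_sol_const.
- exists (phase_formula M a n T0). split; [now apply phase_formula_sol|].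
  now rewrite phase_formula_0.
Qed.

Lemma atan_tan_acute (a : R) : 0 <= a < PI / 2 -> atan (tan a) = a.
Proof. intros Ha. pose proof PI_RGT_0. apply atan_tan; lra. Qed.

(** The chart coordinate approaches [tan a] exponentially, and [atan] is 1-Lipschitz. *)
Lemma phase_tends (M a : R) (f : R -> R) :
  0 < M -> 0 <= a < PI / 2 -> phase_sol M a f -> sin (f 0) <> sin a ->
  exists n : Z, forall eta, 0 < eta ->
    exists N, forall t, N <= t -> Rabs (f t - (a + 2 * PI * IZR n)) < eta.
Proof.
intros HM Ha Hf H0.
destruct (phase_global M a f HM Ha Hf) as [[H _]|[n [T0 H]]]; [contradiction|].
exists n. intros eta Heta.
pose proof (cos_pos_acute a Ha) as Ca.
set (K := Rabs (T0 - tan a)). assert (HK : 0 <= K) by apply Rabs_pos.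
assert (HL : 0 < M * cos a) by nra.
(* The crude bound [s < exp s] already makes [2 K exp (- s)] smaller than [eta] as soon as
   [s = M cos a t] satisfies [2 K <= eta s]. *)
exists (2 * K / (eta * (M * cos a))). intros t Ht.
assert (Ht0 : 2 * K <= eta * (M * cos a) * t).
{ apply (Rmult_le_compat_l (eta * (M * cos a))) in Ht; [|nra].
  replace (eta * (M * cos a) * (2 * K / (eta * (M * cos a)))) with (2 * K) in Ht by (field; nra).
  exact Ht. }
rewrite H. unfold phase_formula.
set (x := tan a + _ * _).
replace (_ - _) with (2 * (atan x - atan (tan a))).
2:{ rewrite atan_tan_acute by assumption. ring. }
rewrite Rabs_mult, (Rabs_pos_eq 2) by lra.
pose proof (atan_lipschitz x (tan a)) as Hx.
assert (Hx' : Rabs (x - tan a) = K * exp (- (M * cos a * t))).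
{ unfold x, K. replace (_ - _) with ((T0 - tan a) * exp (- (M * cos a * t))) by ring.
  rewrite Rabs_mult, (Rabs_pos_eq (exp _)); [reflexivity | left; apply exp_pos]. }
rewrite Hx' in Hx.
apply Rle_lt_trans with (2 * (K * exp (- (M * cos a * t)))); [lra|].
rewrite exp_Ropp.
assert (HE : M * cos a * t < exp (M * cos a * t)).
{ pose proof (exp_ineq1_le (M * cos a * t)). lra. }
apply Rmult_lt_reg_r with (exp (M * cos a * t)); [apply exp_pos|].
replace (2 * (K * / exp (M * cos a * t)) * exp (M * cos a * t)) with (2 * K).
- nra.
- field. apply Rgt_not_eq, exp_pos.
Qed.

(** A solution never leaves its chart, so it cannot gain a full turn; and in the chart the time-[T]
    map is an affine contraction, whose only fixed point is [tan a]. *)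
Lemma phase_periodic (M a T : R) (z : Z) (f : R -> R) :
  0 < M -> 0 <= a < PI / 2 -> phase_sol M a f -> 0 < T ->
  f T = f 0 + 2 * PI * IZR z -> sin (f 0) = sin a.
Proof.
intros HM Ha Hf HT Hz.
destruct (phase_global M a f HM Ha Hf) as [[H _]|[n [T0 H]]]; [exact H|].
pose proof (cos_pos_acute a Ha) as Ca. pose proof PI_RGT_0 as P.
rewrite !H, phase_formula_0 in Hz.
rewrite H, phase_formula_0.
unfold phase_formula in Hz. set (x := tan a + _ * _) in Hz.
pose proof (atan_bound x). pose proof (atan_bound T0).
(* Both values of [2 * atan] lie strictly between [- PI] and [PI], so they differ by less than
   [2 PI]. *)
assert (z = 0%Z).
{ apply one_IZR_lt1. split; nra. }
subst z. assert (E : atan x = atan T0) by lra.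
apply (f_equal tan) in E. rewrite !tan_atan in E. unfold x in E.
assert (HE : exp (- (M * cos a * T)) < 1).
{ rewrite <- exp_0. apply exp_increasing. assert (0 < M * cos a * T) by (repeat apply Rmult_lt_0_compat; lra). lra. }
assert (T0 = tan a) by nra. subst T0.
rewrite atan_tan_acute by assumption.
rewrite <- (sin_2PI_shift a n). f_equal. ring.
Qed.

(** In the chart the time-[T] map is affine with slope [exp (- (M * cos a * T))] and fixes [tan a];
    conjugation by the chart does not change the derivative at a fixed point. The sign of [T] is
    left free so that the repelling case can use [- T]. *)
Lemma phase_flow_derive (M a T : R) (n : Z) (F : R -> R -> R) :
  0 < M -> 0 <= a < PI / 2 -> (forall th, phase_sol M a (F th) /\ F th 0 = th) ->
  is_derive (fun th => F th T) (a + 2 * PI * IZR n) (exp (- (M * cos a * T))).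
Proof.
intros HM Ha HF. pose proof (cos_pos_acute a Ha) as Ca. pose proof PI_RGT_0 as P.
apply is_derive_ext_loc with
  (fun th => phase_formula M a n (tan ((th + a) / 2 - PI * IZR n)) T).
- assert (Hr : 0 < PI / 2 - a) by lra.
  (* Within this radius [(th + a) / 2 - PI * IZR n] stays between [- PI / 2] and [PI / 2], where
     [atan] inverts [tan]. *)
  exists (mkposreal _ Hr). intros th Hth.
  change (Rabs (th - (a + 2 * PI * IZR n)) < PI / 2 - a) in Hth.
  apply Rabs_def2 in Hth. destruct (HF th) as [Hs H0].
  apply (phase_unique M a); auto using phase_formula_sol.
  rewrite H0, phase_formula_0, atan_tan; [|split]; lra.
- unfold phase_formula.
  set (E := exp (- (M * cos a * T))).
  evar_last.
  + apply (is_derive_plus (fun _ => 2 * PI * IZR n - a)).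
    * apply (@is_derive_const R_AbsRing R_NormedModule).
    * apply (is_derive_scal (fun th => atan (tan a + (tan ((th + a) / 2 - PI * IZR n) - tan a) * E))).
      apply (is_derive_comp atan (fun th => tan a + (tan ((th + a) / 2 - PI * IZR n) - tan a) * E)).
      -- apply is_derive_atan.
      -- apply (is_derive_plus (fun _ => tan a)).
         ++ apply (@is_derive_const R_AbsRing R_NormedModule).
         ++ apply (is_derive_ext (fun th => E * (tan ((th + a) / 2 - PI * IZR n) - tan a))).
            { intros th; apply Rmult_comm. }
            apply (is_derive_scal (fun th => tan ((th + a) / 2 - PI * IZR n) - tan a)).
            apply (is_derive_minus (fun th => tan ((th + a) / 2 - PI * IZR n)) (fun _ => tan a)).
            ** apply (is_derive_comp tan (fun th => (th + a) / 2 - PI * IZR n)).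
               --- apply is_derive_tan.
                   replace (_ - _) with a by field. lra.
               --- auto_derive; [trivial | reflexivity].
            ** apply (@is_derive_const R_AbsRing R_NormedModule).
  + cbn -[tan]. unfold plus, minus, opp, zero, scal, mult, plus; simpl. unfold mult; simpl.
    replace ((a + 2 * PI * IZR n + a) / 2 - PI * IZR n) with a by field.
    rewrite Rsqr_pow2. as_real.
    field. nra.
Qed.

(** The reflected family, run backwards, is again a family of solutions, so this is the attracting
    case at time [- T]. The two reflections contribute the factor [(-1) * (-1)] to the
    derivative. *)
Lemma phase_flow_derive_repelling (M a T : R) (n : Z) (F : R -> R -> R) :
  0 < M -> 0 <= a < PI / 2 -> (forall th, phase_sol M a (F th) /\ F th 0 = th) ->
  is_derive (fun th => F th T) (PI - a + 2 * PI * IZR n) (exp (M * cos a * T)).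
Proof.
intros HM Ha HF.
assert (D := phase_flow_derive M a (- T) (- n)
  (fun th t => PI - F (PI - th) (- t)) HM Ha).
simpl in D.
apply is_derive_ext with (fun th => PI - (PI - F (PI - (PI - th)) (- - T))).
{ assert (E : forall th : R, PI - (PI - F (PI - (PI - th)) (- - T)) = F th T).
  { intros th. rewrite Ropp_involutive. replace (PI - (PI - th)) with th by ring. ring. }
  exact E. }
evar_last.
- apply (is_derive_minus (fun _ => PI) (fun th => PI - F (PI - (PI - th)) (- - T))).
  + apply (@is_derive_const R_AbsRing R_NormedModule).
  + apply (is_derive_comp (fun th => PI - F (PI - th) (- - T)) (fun th => PI - th)).
    * replace (PI - _) with (a + 2 * PI * IZR (- n)) by (rewrite opp_IZR; as_real; ring).
      apply D. intros th. destruct (HF (PI - th)) as [H1 H2]. split.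
      -- now apply phase_sol_reverse.
      -- rewrite Ropp_0, H2. as_real; ring.
    * auto_derive; [trivial | reflexivity].
- unfold minus, plus, opp, zero, scal, mult; simpl. unfold mult; simpl.
  replace (- (M * cos a * - T)) with (M * cos a * T) by ring. as_real; ring.
Qed.

(** * The coordinate [u] and closed lines on the torus *)

Definition ucoord (k l : nat) (p : pt) : R := INR l * snd p - INR k * fst p.

(** For [c = level m b i] this unfolds to [Ccurve], so critical curves and cycles share all results
    on lines. *)
Definition line (k l : nat) (c : R) (p : pt) : Prop :=
  exists z : Z, ucoord k l p = c + 2 * PI * IZR z.

Lemma pt_ext (k l : nat) (p q : pt) :
  (1 <= k)%nat -> snd p = snd q -> ucoord k l p = ucoord k l q -> p = q.
Proof.
intros Hk H1 H2. apply le_INR in Hk. simpl in Hk.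
destruct p as [x y], q as [x' y']. unfold ucoord in H2. simpl in *. subst y'. f_equal. nra.
Qed.

Lemma teq_refl (p : pt) : teq p p.
Proof. exists 0%Z, 0%Z. split; ring. Qed.

Lemma ucoord_teq (k l : nat) (p q : pt) :
  teq p q -> exists z : Z, ucoord k l p = ucoord k l q + 2 * PI * IZR z.
Proof.
intros [A [B [HA HB]]]. exists (Z.of_nat l * B - Z.of_nat k * A)%Z.
rewrite minus_IZR, !mult_IZR, <- !INR_IZR_INZ. unfold ucoord.
replace (fst p) with (fst q + 2 * PI * IZR A) by lra.
replace (snd p) with (snd q + 2 * PI * IZR B) by lra. ring.
Qed.

Lemma fst_le_dist2 (p q : pt) : Rabs (fst p - fst q) <= dist2 p q.
Proof.
unfold dist2. destruct (sqrt_plus_sqr (fst p - fst q) (snd p - snd q)) as [H _].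
eapply Rle_trans; [apply Rmax_l | exact H].
Qed.

Lemma snd_le_dist2 (p q : pt) : Rabs (snd p - snd q) <= dist2 p q.
Proof.
unfold dist2. destruct (sqrt_plus_sqr (fst p - fst q) (snd p - snd q)) as [H _].
eapply Rle_trans; [apply Rmax_r | exact H].
Qed.

Lemma dist2_horizontal (p q : pt) : snd p = snd q -> dist2 p q = Rabs (fst p - fst q).
Proof.
intros H. unfold dist2. rewrite H, Rminus_diag, pow_i, Rplus_0_r, <- Rsqr_pow2 by lia.
apply sqrt_Rsqr_abs.
Qed.

Lemma ucoord_lipschitz (k l : nat) (p q : pt) :
  Rabs (ucoord k l p - ucoord k l q) <= (INR l + INR k) * dist2 p q.
Proof.
pose proof (fst_le_dist2 p q). pose proof (snd_le_dist2 p q).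
pose proof (pos_INR l). pose proof (pos_INR k).
unfold ucoord.
replace (_ - _) with (INR l * (snd p - snd q) + - (INR k * (fst p - fst q))) by ring.
eapply Rle_trans; [apply Rabs_triang|].
rewrite Rabs_Ropp, !Rabs_mult, !(Rabs_pos_eq (INR _)) by assumption. nra.
Qed.

(** Translation by [2 PI (A, B)] raises [ucoord] by [2 PI], which links the parallel lifts of a
    line. Coprimality acts through this vector. *)
Lemma bezout_INR (k l : nat) :
  (1 <= k)%nat -> Nat.gcd k l = 1%nat ->
  exists A B : Z, INR l * IZR B - INR k * IZR A = 1.
Proof.
intros Hk Hg. destruct (Nat.gcd_bezout_pos k l) as [a [b H]]; [lia|].
rewrite Hg in H. exists (- Z.of_nat a)%Z, (- Z.of_nat b)%Z.
rewrite !opp_IZR, <- !INR_IZR_INZ.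
apply (f_equal INR) in H. rewrite plus_INR, !mult_INR in H. simpl in H. lra.
Qed.

Lemma line_param (k l : nat) (c : R) (p q : pt) :
  (1 <= k)%nat -> Nat.gcd k l = 1%nat -> line k l c p ->
  line k l c q <-> exists s, teq q (fst p + INR l * s, snd p + INR k * s).
Proof.
intros Hk Hg [zp Hp]. assert (Hk' := le_INR _ _ Hk). simpl in Hk'.
split.
- intros [zq Hq]. destruct (bezout_INR k l Hk Hg) as [A [B HAB]].
  set (z := (zq - zp)%Z).
  (* Subtracting [2 PI z (A, B)] from [q] brings it to the lift through [p]; the parameter along the
     direction [(l, k)] is then read off the second coordinate. *)
  exists ((snd q - snd p - 2 * PI * IZR (z * B)) / INR k). exists (z * A)%Z, (z * B)%Z.
  simpl. split; [|field; lra].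
  apply Rmult_eq_reg_l with (INR k); [|lra]. unfold ucoord in *.
  rewrite !mult_IZR.
  transitivity (INR k * (fst q - fst p) - INR l * (snd q - snd p) + 2 * PI * IZR z * (INR l * IZR B)); [field; lra|].
  replace (INR l * IZR B) with (1 + INR k * IZR A) by lra.
  unfold z; rewrite minus_IZR. lra.
- intros [s Hs]. destruct (ucoord_teq k l _ _ Hs) as [z Hz].
  exists (zp + z)%Z. rewrite Hz, plus_IZR. unfold ucoord in *. simpl. lra.
Qed.

(** For injectivity: if the parameters [s1] and [s2] give the same torus point, then [l (s1 - s2)]
    and [k (s1 - s2)] are integers, hence by Bezout so is [s1 - s2], which lies strictly between -1
    and 0. *)
Lemma torus_knot_line (k l : nat) (c : R) :
  (1 <= k)%nat -> Nat.gcd k l = 1%nat -> torus_knot k l (line k l c).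
Proof.
intros Hk Hg. assert (Hk' := le_INR _ _ Hk). simpl in Hk'. pose proof PI_RGT_0 as P.
exists (fun s => (- c / INR k + INR l * (2 * PI * s), INR k * (2 * PI * s))).
split; [|split; [|split]].
- intros s. simpl. split; apply derivable_continuous_pt; eexists; apply is_derive_Reals;
    auto_derive; trivial.
- intros s. simpl. f_equal; ring.
- intros s1 s2 H1 H12 H2 [A [B [HA HB]]]. simpl in HA, HB.
  destruct (bezout_INR k l Hk Hg) as [A' [B' HAB]].
  assert (E1 : INR l * (s1 - s2) = IZR A) by nra.
  assert (E2 : INR k * (s1 - s2) = IZR B) by nra.
  assert (E : s1 - s2 = IZR (A * B' - B * A')).
  { rewrite minus_IZR, !mult_IZR, <- E1, <- E2.
    transitivity ((s1 - s2) * (INR l * IZR B' - INR k * IZR A')); [rewrite HAB|]; ring. }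
  assert (-1 < A * B' - B * A' < 0)%Z; [|lia].
  split; apply lt_IZR; lra.
- intros q.
  rewrite (line_param k l c (- c / INR k, 0) q Hk Hg).
  + simpl. split.
    * intros [s Hs]. exists (s / (2 * PI)).
      replace (2 * PI * (s / (2 * PI))) with s by (field; lra). now rewrite Rplus_0_l in Hs.
    * intros [s Hs]. exists (2 * PI * s). now rewrite Rplus_0_l.
  + exists 0%Z. unfold ucoord. simpl. field. lra.
Qed.

(** * Solutions and flow of [Y_eps] *)

(* [sin a = l eps / k] is the value of [sin theta] on the cycles of [Y_eps]. *)
Definition regime (m k l : nat) (eps a : R) : Prop :=
  (1 <= m)%nat /\ (1 <= k)%nat /\ 0 < eps /\ 0 <= a < PI / 2 /\
  INR l * eps = INR k * sin a.

Lemma theta_ucoord (m k l : nat) (p : pt) : theta m k l p = INR m * ucoord k l p.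
Proof. reflexivity. Qed.

Lemma INR_gt_0 (n : nat) : (1 <= n)%nat -> 0 < INR n.
Proof. intros H. apply lt_0_INR. lia. Qed.

Lemma is_derive_slope_const (f : R -> R) (d : R) :
  (forall t, is_derive f t d) -> forall t, f t = f 0 + d * t.
Proof.
intros H t. destruct (MVT_gen f 0 t (fun _ => d)) as [c [_ Hc]].
- intros; apply H.
- intros. apply derivable_continuous_pt. eexists. apply is_derive_Reals, H.
- lra.
Qed.

Lemma solution_snd (m k l : nat) (eps : R) (s : R -> pt) (t : R) :
  is_solution m k l eps s -> snd (s t) = snd (s 0) + eps * t.
Proof.
intros H. apply (is_derive_slope_const (fun u => snd (s u))). intros u. apply H.
Qed.

Lemma solution_phase (m k l : nat) (eps a : R) (s : R -> pt) :
  regime m k l eps a -> is_solution m k l eps s ->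
  phase_sol (INR m * INR k) a (fun t => theta m k l (s t)).
Proof.
intros (_ & _ & _ & _ & Ha) H t. destruct (H t) as [H1 H2]. unfold theta.
evar_last.
- apply (is_derive_scal (fun t => INR l * snd (s t) - INR k * fst (s t))).
  apply (is_derive_minus (fun t => INR l * snd (s t)) (fun t => INR k * fst (s t))).
  + apply (is_derive_scal (fun t => snd (s t))), H2.
  + apply (is_derive_scal (fun t => fst (s t))), H1.
- unfold minus, plus, opp, Yy, Yx, theta; simpl. rewrite Ha. as_real. ring.
Qed.

(** Given the phase [f] and the affine [y], the first coordinate is forced by [theta = f]; that its
    derivative is [sin f] is exactly the relation [l eps = k sin a]. *)
Lemma solution_exists (m k l : nat) (eps a : R) (p : pt) :
  regime m k l eps a -> exists s, is_solution m k l eps s /\ s 0 = p.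
Proof.
intros (Hm & Hk & _ & Ha & Hs). apply INR_gt_0 in Hm. assert (Hk' := INR_gt_0 _ Hk).
destruct (phase_exists (INR m * INR k) a (theta m k l p) Ha) as [f [Hf H0]].
exists (fun t => ((INR l * (snd p + eps * t) - f t / INR m) / INR k, snd p + eps * t)).
split.
- intros t. simpl. split.
  + assert (Et : theta m k l ((INR l * (snd p + eps * t) - f t / INR m) / INR k, snd p + eps * t) = f t).
    { unfold theta; simpl. field. lra. }
    unfold Yx. rewrite Et.
    pose proof (Hf t) as D.
    auto_derive; [eexists; eassumption|].
    rewrite (is_derive_unique (fun x : R => f x) _ _ D).
    replace (INR l * (eps * 1)) with (INR k * sin a) by lra. field. lra.
  + unfold Yy. auto_derive; [trivial | ring].
- apply (pt_ext k l); [assumption | simpl; ring|].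
  rewrite H0. unfold ucoord, theta; simpl. field. lra.
Qed.

Lemma flow_spec (m k l : nat) (eps a : R) (p : pt) :
  regime m k l eps a -> is_solution m k l eps (flow m k l eps p) /\ flow m k l eps p 0 = p.
Proof.
intros H. apply (epsilon_spec (inhabits (fun _ : R => p))
  (fun s => is_solution m k l eps s /\ s 0 = p)).
now apply (solution_exists m k l eps a).
Qed.

Lemma flow_0 (m k l : nat) (eps a : R) (p : pt) :
  regime m k l eps a -> flow m k l eps p 0 = p.
Proof. intros H. apply (flow_spec m k l eps a p H). Qed.

Lemma flow_snd (m k l : nat) (eps a : R) (p : pt) (t : R) :
  regime m k l eps a -> snd (flow m k l eps p t) = snd p + eps * t.
Proof.
intros H. destruct (flow_spec m k l eps a p H) as [H1 H2].
rewrite (solution_snd m k l eps (flow m k l eps p)) by assumption. now rewrite H2.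
Qed.

Lemma flow_phase (m k l : nat) (eps a : R) (p : pt) :
  regime m k l eps a ->
  phase_sol (INR m * INR k) a (fun t => theta m k l (flow m k l eps p t)).
Proof.
intros H. apply (solution_phase m k l eps a); [assumption|]. apply (flow_spec m k l eps a p H).
Qed.

Lemma regime_rate_pos (m k l : nat) (eps a : R) :
  regime m k l eps a -> 0 < INR m * INR k.
Proof. intros (Hm & Hk & _). apply INR_gt_0 in Hm. apply INR_gt_0 in Hk. nra. Qed.

(** By uniqueness a phase that starts at an equilibrium is constant, and the constant phase together
    with the affine [y] determines the point. *)
Lemma flow_cycle (m k l : nat) (eps a : R) (p : pt) (t : R) :
  regime m k l eps a -> sin (theta m k l p) = sin a ->
  flow m k l eps p t = (fst p + INR l * (eps / INR k * t), snd p + INR k * (eps / INR k * t)).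
Proof.
intros H Hs. pose proof H as (Hm & Hk & _).
assert (Hm' := INR_gt_0 _ Hm). assert (Hk' := INR_gt_0 _ Hk).
apply (pt_ext k l); [assumption| |].
- rewrite (flow_snd m k l eps a) by assumption. simpl. field. lra.
- apply Rmult_eq_reg_l with (INR m); [|lra]. rewrite <- !theta_ucoord.
  transitivity (theta m k l p).
  + apply (phase_unique (INR m * INR k) a (fun t => theta m k l (flow m k l eps p t)) (fun _ => theta m k l p)).
    * eauto using regime_rate_pos.
    * now apply flow_phase.
    * now apply phase_sol_const.
    * now rewrite (flow_0 m k l eps a).
  + unfold theta; simpl. ring.
Qed.

(** * Closed orbits, their periods and multipliers *)

Lemma orbit_refl (m k l : nat) (eps a : R) (p : pt) :
  regime m k l eps a -> orbit m k l eps p p.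
Proof. intros H. exists 0. rewrite (flow_0 m k l eps a) by assumption. apply teq_refl. Qed.

Lemma orbit_line (m k l : nat) (eps a c : R) (p : pt) :
  regime m k l eps a -> Nat.gcd k l = 1%nat ->
  sin (theta m k l p) = sin a -> line k l c p ->
  same_set (orbit m k l eps p) (line k l c).
Proof.
intros H Hg Hs Hp q. pose proof H as (_ & Hk & He & _). assert (Hk' := INR_gt_0 _ Hk).
rewrite (line_param k l c p q Hk Hg Hp). unfold orbit. split.
- intros [t Ht]. rewrite (flow_cycle m k l eps a) in Ht by assumption. eauto.
- intros [s Ht]. exists (s * INR k / eps). rewrite (flow_cycle m k l eps a) by assumption.
  now replace (eps / INR k * (s * INR k / eps)) with s by (field; lra).
Qed.

Lemma line_theta (m k l : nat) (c : R) (p : pt) :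
  line k l c p -> exists z : Z, theta m k l p = INR m * c + 2 * PI * IZR (Z.of_nat m * z).
Proof.
intros [z Hz]. exists z. rewrite theta_ucoord, Hz, mult_IZR, <- INR_IZR_INZ. ring.
Qed.

Lemma line_sin_theta (m k l : nat) (c : R) (p : pt) :
  line k l c p -> sin (theta m k l p) = sin (INR m * c).
Proof.
intros H. destruct (line_theta m k l c p H) as [z ->]. apply sin_2PI_shift.
Qed.

Definition line_base (k : nat) (c : R) : pt := (- c / INR k, 0).

Lemma line_base_line (k l : nat) (c : R) :
  (1 <= k)%nat -> line k l c (line_base k c).
Proof.
intros Hk. apply INR_gt_0 in Hk. exists 0%Z. unfold ucoord, line_base; simpl. field. lra.
Qed.

Lemma cycle_min_period (m k l : nat) (eps a : R) (p : pt) :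
  regime m k l eps a -> Nat.gcd k l = 1%nat -> sin (theta m k l p) = sin a ->
  min_period m k l eps p (2 * PI * INR k / eps).
Proof.
intros H Hg Hs. pose proof H as (_ & Hk & He & _). assert (Hk' := INR_gt_0 _ Hk).
pose proof PI_RGT_0 as P.
split; [|split].
- apply Rdiv_lt_0_compat; nra.
- rewrite (flow_cycle m k l eps a) by assumption.
  exists (Z.of_nat l), (Z.of_nat k). rewrite <- !INR_IZR_INZ. simpl. split; field; lra.
- intros t [Ht1 Ht2] [A [B [HA HB]]].
  rewrite (flow_cycle m k l eps a) in HA, HB by assumption. simpl in HA, HB.
  (* [r] is the elapsed fraction of the claimed period. A return to [p] makes [l r] and [k r]
     integers, hence [r] too by Bezout, although [0 < r < 1]. *)
  set (r := eps / INR k * t / (2 * PI)).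
  assert (Er : eps / INR k * t = 2 * PI * r) by (unfold r; field; lra).
  rewrite Er in HA, HB.
  assert (E1 : INR l * r = IZR A) by nra.
  assert (E2 : INR k * r = IZR B) by nra.
  destruct (bezout_INR k l Hk Hg) as [A' [B' HAB]].
  assert (E : r = IZR (A * B' - B * A')).
  { rewrite minus_IZR, !mult_IZR, <- E1, <- E2.
    transitivity (r * (INR l * IZR B' - INR k * IZR A')); [rewrite HAB|]; ring. }
  assert (0 < r < 1).
  { unfold r. split.
    - repeat apply Rdiv_lt_0_compat; try lra. apply Rmult_lt_0_compat; [|lra].
      now apply Rdiv_lt_0_compat.
    - apply Rmult_lt_reg_r with (2 * PI * INR k / eps).
      { apply Rdiv_lt_0_compat; nra. }
      rewrite Rmult_1_l. replace (_ * _) with t by (field; lra). exact Ht2. }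
  assert (0 < A * B' - B * A' < 1)%Z; [|lia].
  split; apply lt_IZR; lra.
Qed.

Lemma periodic_orbit_line (m k l : nat) (eps a c : R) :
  regime m k l eps a -> Nat.gcd k l = 1%nat -> sin (INR m * c) = sin a ->
  periodic_orbit m k l eps (line k l c).
Proof.
intros H Hg Hs. pose proof H as (_ & Hk & He & _). pose proof PI_RGT_0 as P.
assert (Hb := line_base_line k l c Hk).
assert (Hs' : sin (theta m k l (line_base k c)) = sin a).
{ now rewrite (line_sin_theta m k l c). }
destruct (cycle_min_period m k l eps a _ H Hg Hs') as [HT [HT' _]].
exists (line_base k c), (2 * PI * INR k / eps). repeat split; try assumption.
(* At this time [y] has advanced by [PI], half a turn, which is not a lattice displacement. *)
- exists (PI / eps). intros [_ [B [_ HB]]].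
  rewrite (flow_snd m k l eps a) in HB by assumption.
  assert (E : 2 * IZR B = 1).
  { replace (snd _ + _ - _) with PI in HB by (field; lra). nra. }
  rewrite <- mult_IZR in E. apply eq_IZR in E. lia.
- apply (orbit_line m k l eps a c (line_base k c) H Hg Hs' Hb).
- apply (orbit_line m k l eps a c (line_base k c) H Hg Hs' Hb).
Qed.

Lemma periodic_orbit_equilibrium (m k l : nat) (eps a : R) (O : pt -> Prop) :
  regime m k l eps a -> periodic_orbit m k l eps O ->
  exists p, O p /\ sin (theta m k l p) = sin a /\ same_set O (orbit m k l eps p).
Proof.
intros H (p & T & HT & Hp & _ & HO). pose proof H as (_ & _ & _ & Ha & _).
exists p. split; [|split; [|assumption]].
- apply HO. now apply (orbit_refl m k l eps a).
- destruct (ucoord_teq k l _ _ Hp) as [z Hz].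
  pose proof (phase_periodic (INR m * INR k) a T (Z.of_nat m * z)
    (fun t => theta m k l (flow m k l eps p t))) as Q.
  cbv beta in Q. rewrite (flow_0 m k l eps a) in Q by assumption.
  apply Q; eauto using regime_rate_pos, flow_phase.
  rewrite !theta_ucoord, Hz, mult_IZR, <- INR_IZR_INZ. ring.
Qed.

(** On the section the phase is an affine function of [x] with slope [- m k]. The return map and the
    phase map are therefore conjugate up to a constant shift and have the same derivative. *)
Lemma poincare_derive (m k l : nat) (eps a T d : R) (p : pt) :
  regime m k l eps a ->
  (forall F, (forall th, phase_sol (INR m * INR k) a (F th) /\ F th 0 = th) ->
     is_derive (fun th => F th T) (theta m k l p) d) ->
  is_derive (poincare m k l eps p T) (fst p) d.
Proof.
intros H HF. pose proof H as (Hm & Hk & _).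
assert (Hm' := INR_gt_0 _ Hm). assert (Hk' := INR_gt_0 _ Hk).
(* The phase along the orbit that starts at the point of the section with phase [th]. *)
set (F := fun th t =>
  theta m k l (flow m k l eps ((INR l * snd p - th / INR m) / INR k, snd p) t)).
assert (HF1 : forall th, phase_sol (INR m * INR k) a (F th) /\ F th 0 = th).
{ intros th. split; [now apply flow_phase|].
  unfold F. rewrite (flow_0 m k l eps a) by assumption. unfold theta; simpl. field. lra. }
assert (D := HF F HF1).
set (C := fst (flow m k l eps p T) - fst p).
set (G := fun x => (INR l * (snd p + eps * T) - F (theta m k l (x, snd p)) T / INR m) / INR k - C).
assert (E : forall x : R, G x = poincare m k l eps p T x).
{ intros x. unfold G, poincare, F. fold C. f_equal.
  replace ((INR l * snd p - theta m k l (x, snd p) / INR m) / INR k) with x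
    by (unfold theta; simpl; field; lra).
  unfold theta at 1. rewrite (flow_snd m k l eps a) by assumption. simpl. field. lra. }
apply (is_derive_ext G _ _ _ E).
assert (Dx : is_derive (fun x => F (theta m k l (x, snd p)) T) (fst p) (- (INR m * INR k) * d)).
{ apply (is_derive_comp (fun th => F th T) (fun x => theta m k l (x, snd p))).
  - now rewrite <- surjective_pairing.
  - unfold theta; simpl. auto_derive; [trivial | ring]. }
unfold G.
evar_last.
- apply (is_derive_minus (fun x => (INR l * (snd p + eps * T) - F (theta m k l (x, snd p)) T / INR m) / INR k) (fun _ => C)).
  + apply (is_derive_ext (fun x => / INR k * (INR l * (snd p + eps * T) - / INR m * F (theta m k l (x, snd p)) T))).
    { intros x. as_real. field. lra. }
    apply (is_derive_scal (fun x => INR l * (snd p + eps * T) - / INR m * F (theta m k l (x, snd p)) T)).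
    apply (is_derive_minus (fun _ => INR l * (snd p + eps * T))).
    * apply (@is_derive_const R_AbsRing R_NormedModule).
    * apply (is_derive_scal (fun x => F (theta m k l (x, snd p)) T)), Dx.
  + apply (@is_derive_const R_AbsRing R_NormedModule).
- unfold minus, plus, opp, zero; simpl. as_real. field. lra.
Qed.

Lemma hyp_attracting_cycle (m k l : nat) (eps a : R) (O : pt -> Prop) (p : pt) (n : Z) :
  regime m k l eps a -> Nat.gcd k l = 1%nat -> O p ->
  theta m k l p = a + 2 * PI * IZR n -> hyp_attracting m k l eps O.
Proof.
intros H Hg Hp Hn. pose proof H as (_ & Hk & He & Ha & _).
assert (Hs : sin (theta m k l p) = sin a) by (rewrite Hn; apply sin_2PI_shift).
assert (HT := cycle_min_period m k l eps a p H Hg Hs).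
assert (HM := regime_rate_pos _ _ _ _ _ H). pose proof (cos_pos_acute a Ha) as Ca.
set (T := 2 * PI * INR k / eps) in *.
exists p, T, (exp (- (INR m * INR k * cos a * T))). split; [assumption|split; [assumption|split]].
- apply (poincare_derive m k l eps a); [assumption|].
  intros F HF. rewrite Hn. now apply phase_flow_derive.
- rewrite Rabs_pos_eq by (left; apply exp_pos). rewrite <- exp_0. apply exp_increasing.
  destruct HT as [HT _].
  assert (0 < INR m * INR k * cos a * T) by (apply Rmult_lt_0_compat; [apply Rmult_lt_0_compat|]; lra). lra.
Qed.

Lemma hyp_repelling_cycle (m k l : nat) (eps a : R) (O : pt -> Prop) (p : pt) (n : Z) :
  regime m k l eps a -> Nat.gcd k l = 1%nat -> O p ->
  theta m k l p = PI - a + 2 * PI * IZR n -> hyp_repelling m k l eps O.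
Proof.
intros H Hg Hp Hn. pose proof H as (_ & Hk & He & Ha & _).
assert (Hs : sin (theta m k l p) = sin a).
{ rewrite Hn, sin_2PI_shift. apply sin_PI_x. }
assert (HT := cycle_min_period m k l eps a p H Hg Hs).
assert (HM := regime_rate_pos _ _ _ _ _ H). pose proof (cos_pos_acute a Ha) as Ca.
set (T := 2 * PI * INR k / eps) in *.
exists p, T, (exp (INR m * INR k * cos a * T)). split; [assumption|split; [assumption|split]].
- apply (poincare_derive m k l eps a); [assumption|].
  intros F HF. rewrite Hn. now apply phase_flow_derive_repelling.
- rewrite Rabs_pos_eq by (left; apply exp_pos). rewrite <- exp_0. apply exp_increasing.
  destruct HT as [HT _]. apply Rmult_lt_0_compat; [apply Rmult_lt_0_compat|]; lra.
Qed.

(* The sign [sigma = 1] or [-1] treats omega- and alpha-limit sets together. *)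
Lemma limit_set_line (m k l : nat) (eps a sigma c : R) (p : pt) :
  regime m k l eps a -> Nat.gcd k l = 1%nat -> sigma = 1 \/ sigma = -1 ->
  (forall eta, 0 < eta -> exists N, forall t, N <= sigma * t ->
     Rabs (ucoord k l (flow m k l eps p t) - c) < eta) ->
  forall q, (forall delta T, 0 < delta -> exists t, T <= sigma * t /\
               near (teq q) delta (flow m k l eps p t)) <-> line k l c q.
Proof.
intros H Hg Hsg Hlim q. pose proof H as (_ & Hk & He & _). assert (Hk' := INR_gt_0 _ Hk).
pose proof PI_RGT_0 as P. pose proof (pos_INR l) as Hl.
split.
- intros Hq.
  destruct (nearest_integer ((ucoord k l q - c) / (2 * PI))) as [z0 [Hz1 Hz2]].
  (* [r] is the signed offset of [u] at [q] from the nearest level [c + 2 PI z], so it must be shown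
     to vanish. *)
  set (r := ucoord k l q - c - 2 * PI * IZR z0).
  assert (Er : (ucoord k l q - c) / (2 * PI) - IZR z0 = r / (2 * PI)) by (unfold r; field; lra).
  assert (Er' : r = r / (2 * PI) * (2 * PI)) by (field; lra).
  rewrite Er in Hz1, Hz2.
  assert (Hr : - PI <= r <= PI) by (split; nra).
  destruct (Req_dec r 0) as [Hr0|Hr0]; [exists z0; unfold r in Hr0; lra|exfalso].
  assert (Hr1 : 0 < Rabs r) by now apply Rabs_pos_lt.
  assert (Hr2 : Rabs r <= PI) by (apply Rabs_le; lra).
  (* Half of [Rabs r] goes to the convergence of the orbit, half to the distance from it, measured
     with the Lipschitz constant [l + k] of [ucoord]. *)
  destruct (Hlim (Rabs r / 2)) as [N HN]; [lra|].
  destruct (Hq (Rabs r / 2 / (INR l + INR k)) N) as [t [Ht [q' [Hq' Hd]]]].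
  { apply Rdiv_lt_0_compat; lra. }
  specialize (HN t Ht).
  destruct (ucoord_teq k l _ _ Hq') as [z Hz].
  pose proof (ucoord_lipschitz k l (flow m k l eps p t) q') as HL. rewrite Rabs_minus_sym in HL.
  apply (Rmult_lt_compat_l (INR l + INR k)) in Hd; [|lra].
  replace ((INR l + INR k) * (Rabs r / 2 / (INR l + INR k))) with (Rabs r / 2) in Hd by (field; lra).
  assert (Hc : Rabs (ucoord k l q' - c) < Rabs r).
  { replace (_ - _) with ((ucoord k l q' - ucoord k l (flow m k l eps p t)) +
      (ucoord k l (flow m k l eps p t) - c)) by ring.
    eapply Rle_lt_trans; [apply Rabs_triang|]. lra. }
  replace (ucoord k l q' - c) with (r + 2 * PI * IZR (z0 - z)) in Hc
    by (rewrite minus_IZR; unfold r; lra).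
  (* A nonzero shift by [2 PI j] would leave an offset of size at least
     [2 PI - Rabs r >= Rabs r]. *)
  destruct (Z.lt_trichotomy (z0 - z) 0) as [Hj|[Hj|Hj]].
  + assert (IZR (z0 - z) <= -1) by (apply IZR_le; lia).
    apply Rabs_def2 in Hc. assert (2 * PI * IZR (z0 - z) <= - (2 * PI)) by nra.
    unfold Rabs in *; destruct (Rcase_abs r); lra.
  + rewrite Hj, Rmult_0_r, Rplus_0_r in Hc. lra.
  + assert (1 <= IZR (z0 - z)) by (apply IZR_le; lia).
    apply Rabs_def2 in Hc. assert (2 * PI <= 2 * PI * IZR (z0 - z)) by nra.
    unfold Rabs in *; destruct (Rcase_abs r); lra.
- intros [z Hz] delta T Hd.
  destruct (Hlim (INR k * delta)) as [N HN]; [nra|].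
  destruct (bezout_INR k l Hk Hg) as [A [B HAB]].
  assert (Hsg' : exists s : Z, sigma = IZR s /\ sigma * sigma = 1).
  { destruct Hsg as [->| ->]; [exists 1%Z | exists (-1)%Z]; lra. }
  destruct Hsg' as [s [Hs Hss]].
  (* The lift [q'] of [q] is sought with [u = c] exactly: subtracting [2 PI z (A, B)] corrects [u],
     and adding multiples of [2 PI (l, k)] keeps [u] while moving [y] arbitrarily far. The time [t]
     is the one at which the orbit reaches the height of [q'], and [n > X] makes [sigma * t]
     large. *)
  set (base := sigma * (snd q - 2 * PI * IZR z * IZR B - snd p)).
  set (X := eps * (Rabs T + Rabs N) + Rabs base).
  set (n := up X).
  assert (HX : X < IZR n) by apply archimed.
  assert (HX0 : 0 <= X).
  { unfold X. pose proof (Rabs_pos T). pose proof (Rabs_pos N). pose proof (Rabs_pos base). nra. }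
  set (A' := (- z * A + Z.of_nat l * s * n)%Z).
  set (B' := (- z * B + Z.of_nat k * s * n)%Z).
  set (q' := (fst q + 2 * PI * IZR A', snd q + 2 * PI * IZR B')).
  set (t := (snd q' - snd p) / eps).
  assert (Ht : sigma * t = (base + 2 * PI * INR k * IZR n) / eps).
  { unfold t, q', B', base; simpl. rewrite plus_IZR, !mult_IZR, opp_IZR, <- INR_IZR_INZ, <- Hs.
    apply Rmult_eq_reg_r with eps; [|lra].
    transitivity (sigma * (snd q + 2 * PI * (- IZR z * IZR B) - snd p) + (sigma * sigma) * (2 * PI * INR k * IZR n)).
    - field; lra.
    - rewrite Hss. field. lra. }
  assert (Ht' : Rabs T + Rabs N <= sigma * t).
  { rewrite Ht. apply Rmult_le_reg_r with eps; [assumption|].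
    replace (_ / eps * eps) with (base + 2 * PI * INR k * IZR n) by (field; lra).
    assert (IZR n <= 2 * PI * INR k * IZR n).
    { assert (1 <= INR k) by (apply (le_INR 1); assumption).
      assert (1 <= 2 * PI * INR k) by (pose proof PI2_1; nra). nra. }
    pose proof (Rle_abs (- base)) as Q. rewrite Rabs_Ropp in Q. unfold X in HX. lra. }
  pose proof (Rle_abs T). pose proof (Rle_abs N). pose proof (Rabs_pos T). pose proof (Rabs_pos N).
  exists t. split; [lra|].
  exists q'. split.
  + exists (- A')%Z, (- B')%Z. unfold q'; simpl. rewrite !opp_IZR. split; ring.
  + assert (Es : snd q' = snd (flow m k l eps p t)).
    { rewrite (flow_snd m k l eps a) by assumption. unfold t. field. lra. }
    assert (Eu : ucoord k l q' = c).
    { unfold ucoord in *. unfold q', A', B'; simpl.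
      rewrite !plus_IZR, !mult_IZR, !opp_IZR, <- !INR_IZR_INZ.
      transitivity (INR l * snd q - INR k * fst q - 2 * PI * IZR z * (INR l * IZR B - INR k * IZR A)); [ring|].
      rewrite HAB, Hz. ring. }
    rewrite dist2_horizontal by now symmetry.
    rewrite Rabs_minus_sym.
    specialize (HN t ltac:(lra)). rewrite <- Eu in HN.
    apply Rmult_lt_reg_l with (INR k); [assumption|].
    rewrite <- (Rabs_pos_eq (INR k)) at 1 by lra. rewrite <- Rabs_mult.
    unfold ucoord in HN. rewrite Es in HN.
    now replace (INR k * _) with (INR l * snd (flow m k l eps p t) - INR k * fst (flow m k l eps p t) -
      (INR l * snd (flow m k l eps p t) - INR k * fst q')) by ring.
Qed.

(** * Levels of the cycles and the admissible range of [eps] *)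

Definition slow_angle (k l : nat) (eps : R) : R := asin (INR l * eps / INR k).

Definition cycle_level (m k l : nat) (b : bool) (i : nat) (eps : R) : R :=
  if b then level m b i - slow_angle k l eps / INR m
  else level m b i + slow_angle k l eps / INR m.

Definition cycle (m k l : nat) (b : bool) (i : nat) (eps : R) : pt -> Prop :=
  line k l (cycle_level m k l b i eps).

(** Keeps [l eps / k] below 1/2, away from the value 1 at which attracting and repelling equilibria
    merge; the [+ 1] covers [l = 0]. *)
Definition eps_bound (k l : nat) : R := INR k / (2 * (INR l + 1)).

Lemma eps_bound_pos (k l : nat) : (1 <= k)%nat -> 0 < eps_bound k l.
Proof.
intros Hk. apply INR_gt_0 in Hk. pose proof (pos_INR l).
apply Rdiv_lt_0_compat; lra.
Qed.

Lemma regime_slow_angle (m k l : nat) (eps : R) :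
  (1 <= m)%nat -> (1 <= k)%nat -> 0 < eps <= eps_bound k l ->
  regime m k l eps (slow_angle k l eps).
Proof.
intros Hm Hk [He1 He2]. assert (Hk' := INR_gt_0 _ Hk). pose proof (pos_INR l) as Hl.
set (r := INR l * eps / INR k).
assert (Er : INR l * eps = INR k * r) by (unfold r; field; lra).
assert (He3 : eps * (2 * (INR l + 1)) <= INR k).
{ apply (Rmult_le_compat_r (2 * (INR l + 1))) in He2; [|lra].
  unfold eps_bound in He2. replace (_ / _ * _) with (INR k) in He2 by (field; lra). exact He2. }
assert (Hr : 0 <= r <= 1 / 2) by (split; nra).
assert (Es : sin (slow_angle k l eps) = r) by (apply sin_asin; lra).
assert (Hb : - (PI / 2) < slow_angle k l eps < PI / 2) by (apply asin_bound_lt; fold r; lra).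
repeat split; try assumption.
- destruct (Rle_lt_dec 0 (slow_angle k l eps)) as [Q|Q]; [exact Q|].
  pose proof PI_RGT_0. assert (sin (slow_angle k l eps) < 0) by (apply sin_lt_0_var; lra). lra.
- apply Hb.
- now rewrite Es.
Qed.

Lemma slow_angle_small (k l : nat) (eta : R) :
  (1 <= k)%nat -> 0 < eta ->
  exists e1, 0 < e1 <= eps_bound k l /\
    forall eps, 0 < eps <= e1 -> slow_angle k l eps < eta.
Proof.
intros Hk Heta. assert (Hk' := INR_gt_0 _ Hk). pose proof (pos_INR l) as Hl.
pose proof PI_RGT_0 as P. pose proof (eps_bound_pos k l Hk) as Hb.
set (h := Rmin (eta / 2) (PI / 4)).
assert (Hh : 0 < h <= PI / 4 /\ h < eta).
{ unfold h. pose proof (Rmin_l (eta / 2) (PI / 4)). pose proof (Rmin_r (eta / 2) (PI / 4)).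
  pose proof (Rmin_glb_lt (eta / 2) (PI / 4) 0). lra. }
assert (Hsh : 0 < sin h) by (apply sin_gt_0; lra).
(* The second bound gives [l eps < (l + 1) eps <= k sin h], that is [sin a < sin h]; the cap
   [PI / 4] in [h] keeps both angles where [sin] increases. *)
exists (Rmin (eps_bound k l) (INR k * sin h / (INR l + 1))). split; [split|].
- apply Rmin_glb_lt; [assumption|]. apply Rdiv_lt_0_compat; nra.
- apply Rmin_l.
- intros eps [He1 He2].
  assert (He3 := Rle_trans _ _ _ He2 (Rmin_l _ _)).
  assert (He4 := Rle_trans _ _ _ He2 (Rmin_r _ _)).
  destruct (regime_slow_angle 1 k l eps) as (_ & _ & _ & Ha & Es); auto.
  apply (Rmult_le_compat_r (INR l + 1)) in He4; [|lra].
  replace (_ / _ * _) with (INR k * sin h) in He4 by (field; lra).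
  destruct (Rle_lt_dec (slow_angle k l eps) h) as [Q|Q]; [lra|].
  assert (sin h < sin (slow_angle k l eps)) by (apply sin_increasing_1; lra).
  nra.
Qed.

Lemma cycle_phase (m k l : nat) (b : bool) (i : nat) (eps : R) :
  (1 <= m)%nat ->
  INR m * cycle_level m k l b i eps =
  (if b then PI - slow_angle k l eps else slow_angle k l eps) + 2 * PI * IZR (Z.of_nat i - 1).
Proof.
intros Hm. apply INR_gt_0 in Hm. rewrite minus_IZR, <- INR_IZR_INZ.
destruct b; unfold cycle_level, level; field; lra.
Qed.

Lemma cycle_theta (m k l : nat) (b : bool) (i : nat) (eps : R) (p : pt) :
  (1 <= m)%nat -> cycle m k l b i eps p -> exists n : Z,
  theta m k l p = (if b then PI - slow_angle k l eps else slow_angle k l eps) + 2 * PI * IZR n.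
Proof.
intros Hm Hp. destruct (line_theta m k l _ p Hp) as [z Hz].
exists (Z.of_nat i - 1 + Z.of_nat m * z)%Z. rewrite Hz, cycle_phase, plus_IZR by assumption. ring.
Qed.

Lemma cycle_sin_theta (m k l : nat) (b : bool) (i : nat) (eps : R) :
  (1 <= m)%nat -> sin (INR m * cycle_level m k l b i eps) = sin (slow_angle k l eps).
Proof.
intros Hm. rewrite cycle_phase, sin_2PI_shift by assumption.
destruct b; [apply sin_PI_x | reflexivity].
Qed.

(** Equilibrium phases are numbered by all integers, and raising [u] by [2 PI] raises the number by
    [m]: the residue selects the curve, the quotient its lift. *)
Lemma index_decomp (m : nat) (n : Z) :
  (1 <= m)%nat -> exists (i : nat) (z : Z), (1 <= i <= m)%nat /\ n = (Z.of_nat i - 1 + Z.of_nat m * z)%Z.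
Proof.
intros Hm. exists (Z.to_nat (n mod Z.of_nat m + 1)), (n / Z.of_nat m)%Z.
pose proof (Z.mod_pos_bound n (Z.of_nat m) ltac:(lia)).
pose proof (Z.div_mod n (Z.of_nat m) ltac:(lia)). lia.
Qed.

Lemma line_shift (k l : nat) (c c' : R) (z : Z) :
  c = c' + 2 * PI * IZR z -> same_set (line k l c) (line k l c').
Proof.
intros E p. split; intros [j Hj].
- exists (j + z)%Z. rewrite plus_IZR. lra.
- exists (j - z)%Z. rewrite minus_IZR. lra.
Qed.

Lemma equilibrium_line_is_cycle (m k l : nat) (b : bool) (n : Z) (c eps : R) :
  (1 <= m)%nat ->
  INR m * c = (if b then PI - slow_angle k l eps else slow_angle k l eps) + 2 * PI * IZR n ->
  exists i, (1 <= i <= m)%nat /\ same_set (line k l c) (cycle m k l b i eps).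
Proof.
intros Hm Hc. destruct (index_decomp m n Hm) as [i [z [Hi Hn]]].
exists i. split; [assumption|].
apply (line_shift k l _ _ z).
assert (Hm' := INR_gt_0 _ Hm). apply Rmult_eq_reg_l with (INR m); [|lra].
rewrite Hc, Rmult_plus_distr_l, cycle_phase, Hn, plus_IZR, mult_IZR, <- INR_IZR_INZ by assumption. ring.
Qed.

Lemma equilibrium_on_cycle (m k l : nat) (eps : R) (p : pt) :
  (1 <= m)%nat -> sin (theta m k l p) = sin (slow_angle k l eps) ->
  exists b i, (1 <= i <= m)%nat /\ cycle m k l b i eps p.
Proof.
intros Hm Hs.
assert (E : exists (b : bool) (n : Z), INR m * ucoord k l p =
  (if b then PI - slow_angle k l eps else slow_angle k l eps) + 2 * PI * IZR n).
{ destruct (sin_eq_cases _ _ Hs) as [n [Hn|Hn]]; [exists false, n | exists true, n]; exact Hn. }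
destruct E as [b [n Hn]].
destruct (equilibrium_line_is_cycle m k l b n _ eps Hm Hn) as [i [Hi HL]].
exists b, i. split; [assumption|]. apply HL. exists 0%Z. ring.
Qed.

(** * Isolating bands around the critical curves *)

Definition band (m k l : nat) (b : bool) (i : nat) : pt -> Prop :=
  fun p => exists z : Z,
    Rabs (INR l * snd p - INR k * fst p - level m b i - 2 * PI * IZR z) < PI / (2 * INR m).

Lemma band_tubular (m k l : nat) (b : bool) (i : nat) :
  (1 <= m)%nat -> tubular_nbhd m k l b i (band m k l b i).
Proof.
intros Hm. pose proof (le_INR 1 m Hm) as Hm'. simpl in Hm'. pose proof PI_RGT_0.
exists (PI / (2 * INR m)). split; [split|].
- apply Rdiv_lt_0_compat; lra.
- apply Rmult_lt_reg_r with (2 * INR m); [lra|].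
  replace (_ / _ * _) with PI by (field; lra). nra.
- intros p. reflexivity.
Qed.

Lemma band_open (m k l : nat) (b : bool) (i : nat) :
  (1 <= k)%nat -> Defs.open_set (band m k l b i).
Proof.
intros Hk p [z Hz]. apply INR_gt_0 in Hk. pose proof (pos_INR l).
set (d := PI / (2 * INR m)) in *. set (r := Rabs _) in Hz.
exists ((d - r) / (INR l + INR k)). split; [apply Rdiv_lt_0_compat; lra|].
intros q Hq. exists z. fold d.
apply (Rmult_lt_compat_l (INR l + INR k)) in Hq; [|lra].
replace (_ * (_ / _)) with (d - r) in Hq by (field; lra).
pose proof (ucoord_lipschitz k l p q) as HL. rewrite Rabs_minus_sym in HL. unfold ucoord in HL.
replace (INR l * snd q - INR k * fst q - level m b i - 2 * PI * IZR z) with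
  ((INR l * snd q - INR k * fst q - (INR l * snd p - INR k * fst p)) +
   (INR l * snd p - INR k * fst p - level m b i - 2 * PI * IZR z)) by ring.
eapply Rle_lt_trans; [apply Rabs_triang|]. fold r. lra.
Qed.

Lemma cycle_in_band (m k l : nat) (b : bool) (i : nat) (eps : R) :
  regime m k l eps (slow_angle k l eps) -> subset (cycle m k l b i eps) (band m k l b i).
Proof.
intros (Hm & _ & _ & Ha & _) p [z Hz]. apply INR_gt_0 in Hm.
exists z. unfold ucoord in Hz. set (a := slow_angle k l eps) in *.
assert (Q : Rabs (a / INR m) < PI / (2 * INR m)).
{ assert (0 < / INR m) by now apply Rinv_0_lt_compat.
  rewrite Rabs_pos_eq by (unfold Rdiv; nra).
  replace (PI / (2 * INR m)) with (PI / 2 / INR m) by (field; lra). unfold Rdiv at 1 2. nra. }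
destruct b; unfold cycle_level in Hz; fold a in Hz.
- rewrite <- Rabs_Ropp in Q. replace (_ - _) with (- (a / INR m)) by lra. exact Q.
- replace (_ - _) with (a / INR m) by lra. exact Q.
Qed.

(** The half width [PI / (2 m)] in [u] is [PI / 2] in [theta]: the band is centred at a zero of
    [sin] and is as wide as injectivity of [sin] permits. *)
Lemma equilibrium_in_band (m k l : nat) (b : bool) (i : nat) (eps : R) (p : pt) :
  regime m k l eps (slow_angle k l eps) -> band m k l b i p ->
  sin (theta m k l p) = sin (slow_angle k l eps) -> cycle m k l b i eps p.
Proof.
intros (Hm & _ & _ & Ha & _) [z Hz] Hs. apply INR_gt_0 in Hm.
fold (ucoord k l p) in Hz. set (a := slow_angle k l eps) in *.
set (v := INR m * (ucoord k l p - level m b i - 2 * PI * IZR z)).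
assert (Hv : Rabs v < PI / 2).
{ unfold v. rewrite Rabs_mult, (Rabs_pos_eq (INR m)) by lra.
  replace (PI / 2) with (INR m * (PI / (2 * INR m))) by (field; lra).
  now apply Rmult_lt_compat_l. }
apply Rabs_def2 in Hv.
assert (Et : theta m k l p = (if b then PI + v else v) +
  2 * PI * IZR (Z.of_nat i - 1 + Z.of_nat m * z)).
{ rewrite theta_ucoord, plus_IZR, minus_IZR, mult_IZR, <- !INR_IZR_INZ.
  unfold v, level. destruct b; field; lra. }
rewrite Et, sin_2PI_shift in Hs.
exists z. apply Rmult_eq_reg_l with (INR m); [|lra].
destruct b; unfold cycle_level; fold a.
- assert (v = - a).
  { apply sin_inj; [lra | lra |]. rewrite sin_neg, <- Hs, Rplus_comm, neg_sin. ring. }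
  unfold v in *. apply Rminus_diag_uniq. field_simplify; lra.
- assert (v = a) by (apply sin_inj; lra).
  unfold v in *. apply Rminus_diag_uniq. field_simplify; lra.
Qed.

(** Serves twice: for the isolation of each cycle and for its uniqueness in the tubular
    neighbourhood. *)
Lemma periodic_orbit_in_band (m k l : nat) (b : bool) (i : nat) (eps : R) (O : pt -> Prop) :
  regime m k l eps (slow_angle k l eps) -> Nat.gcd k l = 1%nat ->
  periodic_orbit m k l eps O -> subset O (band m k l b i) ->
  same_set O (cycle m k l b i eps).
Proof.
intros H Hg HO HU.
destruct (periodic_orbit_equilibrium _ _ _ _ _ _ H HO) as [p [Hp [Hs HOp]]].
assert (Hc := equilibrium_in_band m k l b i eps p H (HU p Hp) Hs).
intros q. rewrite (HOp q). now apply (orbit_line m k l eps (slow_angle k l eps)).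
Qed.

Lemma cycle_limit_cycle (m k l : nat) (b : bool) (i : nat) (eps : R) :
  regime m k l eps (slow_angle k l eps) -> Nat.gcd k l = 1%nat ->
  limit_cycle m k l eps (cycle m k l b i eps).
Proof.
intros H Hg. pose proof H as (Hm & Hk & _). split.
- apply (periodic_orbit_line m k l eps (slow_angle k l eps)); auto using cycle_sin_theta.
- exists (band m k l b i). split; [|split].
  + now apply band_open.
  + now apply cycle_in_band.
  + intros O HO HU. now apply periodic_orbit_in_band.
Qed.

(** * Critical curves, Hausdorff convergence and canards *)

Lemma normal_eig_eq (m k l : nat) (p : pt) :
  normal_eig m k l p = - (INR m * INR k) * cos (theta m k l p).
Proof.
unfold normal_eig, Yy. rewrite Derive_const, Rplus_0_r.
apply is_derive_unique. unfold Yx, theta; simpl. auto_derive; [trivial | unfold Rminus; ring].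
Qed.

Lemma Ccurve_theta (m k l : nat) (b : bool) (i : nat) (p : pt) :
  (1 <= m)%nat -> Ccurve m k l b i p ->
  exists n : Z, theta m k l p = (if b then PI else 0) + 2 * PI * IZR (Z.of_nat i - 1 + Z.of_nat m * n).
Proof.
intros Hm [z Hz]. apply INR_gt_0 in Hm. exists z.
unfold theta. rewrite Hz, plus_IZR, minus_IZR, mult_IZR, <- !INR_IZR_INZ.
unfold level. destruct b; field; lra.
Qed.

Lemma Ccurve_normal (m k l : nat) (b : bool) (i : nat) (p : pt) :
  (1 <= m)%nat -> (1 <= k)%nat -> Ccurve m k l b i p ->
  if b then normally_repelling m k l p else normally_attracting m k l p.
Proof.
intros Hm Hk Hp. destruct (Ccurve_theta _ _ _ _ _ _ Hm Hp) as [n Hn].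
assert (HM : 0 < INR m * INR k) by (apply INR_gt_0 in Hm; apply INR_gt_0 in Hk; nra).
destruct b; (split; [split; [unfold Yx | reflexivity] | rewrite normal_eig_eq]);
  rewrite Hn, ?sin_2PI_shift, ?cos_2PI_shift.
- apply sin_PI.
- rewrite cos_PI. lra.
- apply sin_0.
- rewrite cos_0. lra.
Qed.

Lemma Ccurve_disjoint (m k l : nat) (b b' : bool) (i i' : nat) (p : pt) :
  (1 <= i <= m)%nat -> (1 <= i' <= m)%nat -> (b, i) <> (b', i') ->
  ~ (Ccurve m k l b i p /\ Ccurve m k l b' i' p).
Proof.
intros Hi Hi' Hne [H1 H2]. pose proof PI_RGT_0 as P.
destruct (Ccurve_theta m k l b i p ltac:(lia) H1) as [n Hn].
destruct (Ccurve_theta m k l b' i' p ltac:(lia) H2) as [n' Hn'].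
(* Phases on critical curves are counted in units of [PI]: parity then recovers [b], and the residue
   modulo [m] of the half recovers [i]. *)
set (s := fun b : bool => if b then 1%Z else 0%Z).
assert (E : (s b + 2 * (Z.of_nat i - 1 + Z.of_nat m * n) = s b' + 2 * (Z.of_nat i' - 1 + Z.of_nat m * n'))%Z).
{ apply eq_IZR. rewrite !(plus_IZR (s _)), !(mult_IZR 2).
  apply Rmult_eq_reg_l with PI; [|lra].
  transitivity (theta m k l p); [rewrite Hn | rewrite Hn']; unfold s; [destruct b | destruct b']; ring. }
destruct b, b'; unfold s in E; try lia.
all: assert (Hd : (Z.of_nat m * (n' - n) = Z.of_nat i - Z.of_nat i')%Z) by lia;
  assert (n' = n) by nia; subst n'; apply Hne; f_equal; lia.
Qed.

Lemma near_line (k l : nat) (c c' delta : R) (p : pt) :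
  (1 <= k)%nat -> line k l c p -> Rabs (c' - c) < INR k * delta ->
  near (line k l c') delta p.
Proof.
intros Hk [z Hz] Hd. apply INR_gt_0 in Hk. unfold ucoord in Hz.
exists (fst p - (c' - c) / INR k, snd p). split.
- exists z. unfold ucoord; simpl. replace (INR k * _) with (INR k * fst p - (c' - c)) by (field; lra). lra.
- rewrite dist2_horizontal by reflexivity. simpl.
  replace (fst p - _) with ((c' - c) / INR k) by ring.
  unfold Rdiv. rewrite Rabs_mult, (Rabs_pos_eq (/ _)) by (left; now apply Rinv_0_lt_compat).
  apply Rmult_lt_reg_l with (INR k); [assumption|].
  now replace (INR k * (_ * _)) with (Rabs (c' - c)) by (field; lra).
Qed.

Lemma cycle_level_dist (m k l : nat) (b : bool) (i : nat) (eta : R) :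
  (1 <= m)%nat -> (1 <= k)%nat -> 0 < eta ->
  exists e1, 0 < e1 /\ forall eps, 0 < eps <= e1 ->
    regime m k l eps (slow_angle k l eps) /\
    Rabs (cycle_level m k l b i eps - level m b i) < eta.
Proof.
intros Hm Hk Heta. assert (Hm' := INR_gt_0 _ Hm).
destruct (slow_angle_small k l (INR m * eta) Hk ltac:(nra)) as [e1 [[He1 Hb] He]].
exists e1. split; [assumption|]. intros eps Heps.
assert (H : regime m k l eps (slow_angle k l eps)) by (apply regime_slow_angle; auto; lra).
split; [assumption|]. destruct H as (_ & _ & _ & Ha & _). specialize (He eps Heps).
set (a := slow_angle k l eps) in *.
assert (Q : Rabs (a / INR m) < eta).
{ rewrite Rabs_pos_eq.
  - apply Rmult_lt_reg_l with (INR m); [assumption|].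
    now replace (INR m * (a / INR m)) with a by (field; lra).
  - apply Rdiv_le_0_compat; lra. }
destruct b; unfold cycle_level; fold a.
- rewrite <- Rabs_Ropp in Q. now replace (_ - _ - _) with (- (a / INR m)) by ring.
- now replace (_ + _ - _) with (a / INR m) by ring.
Qed.

Lemma cycle_hausdorff (m k l : nat) (b : bool) (i : nat) :
  (1 <= m)%nat -> (1 <= k)%nat -> hausdorff_conv (cycle m k l b i) (Ccurve m k l b i).
Proof.
intros Hm Hk delta Hd. assert (Hk' := INR_gt_0 _ Hk).
destruct (cycle_level_dist m k l b i (INR k * delta) Hm Hk ltac:(nra)) as [e1 [He1 He]].
exists e1. split; [assumption|]. intros eps Heps. destruct (He eps Heps) as [_ Hc].
split; intros p Hp.
- apply (near_line k l (cycle_level m k l b i eps)); auto. now rewrite Rabs_minus_sym.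
- now apply (near_line k l (level m b i)).
Qed.

Lemma repelling_cycle_canard (m k l i : nat) :
  (1 <= m)%nat -> (1 <= k)%nat -> canard m k l (cycle m k l true i).
Proof.
intros Hm Hk. assert (Hk' := INR_gt_0 _ Hk).
exists 1. split; [lra|]. intros delta Hd.
destruct (cycle_level_dist m k l true i (INR k * delta) Hm Hk ltac:(nra)) as [e1 [He1 He]].
exists e1. split; [assumption|]. intros eps Heps. destruct (He eps Heps) as [H Hc].
set (c := cycle_level m k l true i eps) in *.
assert (Hp := line_base_line k l c Hk). set (p := line_base k c) in *.
(* During the time [1 / eps] the second coordinate advances by 1, which gives [L = 1] for every
   [eps]. *)
exists p, 0, (1 / eps). split; [assumption|]. split; [|split].
- apply Rdiv_le_0_compat; lra.
- eapply Rle_trans; [|apply snd_le_dist2].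
  rewrite !(flow_snd m k l eps (slow_angle k l eps)) by assumption.
  replace (_ - _) with (-1) by (field; lra). rewrite Rabs_left; lra.
- intros t _ _.
  assert (Hs : sin (theta m k l p) = sin (slow_angle k l eps)).
  { rewrite (line_sin_theta m k l c) by assumption. now apply cycle_sin_theta. }
  assert (Hq : line k l c (flow m k l eps p t)).
  { rewrite (flow_cycle m k l eps (slow_angle k l eps)) by assumption.
    destruct Hp as [z Hz]. exists z. rewrite <- Hz. unfold ucoord; simpl. ring. }
  destruct (near_line k l c (level m true i) delta _ Hk Hq) as [q [Hq1 Hq2]].
  { now rewrite Rabs_minus_sym. }
  exists q. split; [|assumption]. now apply (Ccurve_normal m k l true i).
Qed.

Lemma attracting_cycle_not_canard (m k l i : nat) :
  (1 <= m)%nat -> (1 <= k)%nat -> Nat.gcd k l = 1%nat ->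
  ~ canard m k l (cycle m k l false i).
Proof.
intros Hm Hk Hg [L [HL HC]]. assert (Hm' := INR_gt_0 _ Hm). assert (Hk' := INR_gt_0 _ Hk).
pose proof (pos_INR l) as Hl.
(* On the cycle [cos theta > 0], at normally repelling points [cos theta = -1]. Since [cos theta]
   has Lipschitz constant [m (l + k)], the two sets are at least this far apart, uniformly in
   [eps]. *)
destruct (HC (1 / (INR m * (INR l + INR k)))) as [e1 [He1 He]].
{ apply Rdiv_lt_0_compat; nra. }
destruct (slow_angle_small k l 1 Hk ltac:(lra)) as [e2 [[He2 Hb] _]].
set (eps := Rmin e1 e2).
assert (Heps : 0 < eps <= e1 /\ eps <= e2).
{ unfold eps. pose proof (Rmin_l e1 e2). pose proof (Rmin_r e1 e2).
  pose proof (Rmin_glb_lt e1 e2 0). lra. }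
assert (H : regime m k l eps (slow_angle k l eps)) by (apply regime_slow_angle; auto; lra).
pose proof H as (_ & _ & _ & Ha & _).
destruct (He eps (proj1 Heps)) as [p [t1 [t2 [Hp [Ht [_ Hn]]]]]].
destruct (Hn t1 (Rle_refl _) Ht) as [q [[[Hq1 _] Hq2] Hd]].
destruct (cycle_theta _ _ _ _ _ _ _ Hm Hp) as [n Hn'].
set (r := flow m k l eps p t1) in *.
assert (Hs : sin (theta m k l p) = sin (slow_angle k l eps)) by (rewrite Hn'; apply sin_2PI_shift).
assert (Er : theta m k l r = slow_angle k l eps + 2 * PI * IZR n).
{ unfold r. rewrite (flow_cycle m k l eps (slow_angle k l eps)) by assumption.
  rewrite <- Hn'. unfold theta; simpl. ring. }
assert (Cr : 0 < cos (theta m k l r)) by (rewrite Er, cos_2PI_shift; now apply cos_pos_acute).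
assert (Cq : cos (theta m k l q) = -1).
{ rewrite normal_eig_eq in Hq2. unfold Yx in Hq1.
  pose proof (sin2_cos2 (theta m k l q)) as S. rewrite Hq1 in S. unfold Rsqr in S.
  assert (0 < INR m * INR k) by nra. nra. }
pose proof (sin_lipschitz (PI / 2 - theta m k l r) (PI / 2 - theta m k l q)) as HS.
rewrite !sin_shift, Cq in HS.
replace (_ - _ - _) with (INR m * (ucoord k l q - ucoord k l r)) in HS
  by (rewrite !theta_ucoord; ring).
rewrite Rabs_mult, (Rabs_pos_eq (INR m)) in HS by lra.
pose proof (ucoord_lipschitz k l r q) as HU. rewrite Rabs_minus_sym in HU.
apply (Rmult_lt_compat_l (INR m * (INR l + INR k))) in Hd; [|nra].
replace (_ * (1 / _)) with 1 in Hd by (field; lra).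
apply (Rmult_le_compat_l (INR m)) in HU; [|lra].
pose proof (Rle_abs (cos (theta m k l r) - -1)). lra.
Qed.

(** * Limit sets of the remaining orbits *)

Lemma omega_limit_cycle (m k l : nat) (eps : R) (p : pt) :
  regime m k l eps (slow_angle k l eps) -> Nat.gcd k l = 1%nat ->
  sin (theta m k l p) <> sin (slow_angle k l eps) ->
  exists j, (1 <= j <= m)%nat /\ same_set (omega_limit m k l eps p) (cycle m k l false j eps).
Proof.
intros H Hg Hs. pose proof H as (Hm & Hk & _ & Ha & _). assert (Hm' := INR_gt_0 _ Hm).
set (a := slow_angle k l eps) in *.
destruct (phase_tends (INR m * INR k) a (fun t => theta m k l (flow m k l eps p t))) as [n Hn];
  eauto using regime_rate_pos, flow_phase.
{ now rewrite (flow_0 m k l eps a). }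
set (c := (a + 2 * PI * IZR n) / INR m).
destruct (equilibrium_line_is_cycle m k l false n c eps Hm) as [j [Hj HL]].
{ unfold c. fold a. field. lra. }
exists j. split; [assumption|]. intros q. rewrite <- (HL q).
rewrite <- (limit_set_line m k l eps a 1 c p H Hg (or_introl eq_refl)).
- unfold omega_limit. setoid_rewrite Rmult_1_l. reflexivity.
- intros eta Heta. destruct (Hn (INR m * eta)) as [N HN]; [nra|].
  exists N. intros t Ht. rewrite Rmult_1_l in Ht. specialize (HN t Ht).
  apply Rmult_lt_reg_l with (INR m); [assumption|].
  rewrite <- (Rabs_pos_eq (INR m)) at 1 by lra. rewrite <- Rabs_mult.
  replace (INR m * (_ - c)) with (theta m k l (flow m k l eps p t) - (a + 2 * PI * IZR n)); [assumption|].
  unfold c. rewrite theta_ucoord. field. lra.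
Qed.

Lemma alpha_limit_cycle (m k l : nat) (eps : R) (p : pt) :
  regime m k l eps (slow_angle k l eps) -> Nat.gcd k l = 1%nat ->
  sin (theta m k l p) <> sin (slow_angle k l eps) ->
  exists j, (1 <= j <= m)%nat /\ same_set (alpha_limit m k l eps p) (cycle m k l true j eps).
Proof.
intros H Hg Hs. pose proof H as (Hm & Hk & _ & Ha & _). assert (Hm' := INR_gt_0 _ Hm).
set (a := slow_angle k l eps) in *.
destruct (phase_tends (INR m * INR k) a (fun t => PI - theta m k l (flow m k l eps p (- t)))) as [n Hn];
  eauto using regime_rate_pos.
{ apply (phase_sol_reverse _ _ (fun t => theta m k l (flow m k l eps p t))). now apply flow_phase. }
{ now rewrite Ropp_0, (flow_0 m k l eps a), sin_PI_x. }
(* The reflected, time-reversed phase tends to [a + 2 PI n]; undoing the reflection gives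
   [PI - a - 2 PI n] in backward time, hence the index [- n]. *)
set (c := (PI - a + 2 * PI * IZR (- n)) / INR m).
destruct (equilibrium_line_is_cycle m k l true (- n) c eps Hm) as [j [Hj HL]].
{ unfold c. fold a. field. lra. }
exists j. split; [assumption|]. intros q. rewrite <- (HL q).
rewrite <- (limit_set_line m k l eps a (-1) c p H Hg (or_intror eq_refl)).
- unfold alpha_limit. split; intros Q delta T Hd.
  + destruct (Q delta (- T) Hd) as [t [Ht Ht']]. exists t. split; [lra | assumption].
  + destruct (Q delta (- T) Hd) as [t [Ht Ht']]. exists t. split; [lra | assumption].
- intros eta Heta. destruct (Hn (INR m * eta)) as [N HN]; [nra|].
  exists N. intros t Ht. specialize (HN (- t) ltac:(lra)). rewrite Ropp_involutive in HN.
  apply Rmult_lt_reg_l with (INR m); [assumption|].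
  rewrite <- (Rabs_pos_eq (INR m)) at 1 by lra. rewrite <- Rabs_mult, <- Rabs_Ropp.
  replace (- _) with (PI - theta m k l (flow m k l eps p t) - (a + 2 * PI * IZR n)); [assumption|].
  unfold c. rewrite theta_ucoord, opp_IZR. field. lra.
Qed.

Theorem theorem1p1 (m k l : nat) :
  (1 <= m)%nat -> (1 <= k)%nat -> Nat.gcd k l = 1%nat ->
  (* the curves C^i_{+-} *)
  (forall (b : bool) (i : nat), (1 <= i <= m)%nat ->
     torus_knot k l (Ccurve m k l b i) /\
     (forall p, Ccurve m k l b i p ->
        if b then normally_repelling m k l p else normally_attracting m k l p)) /\
  (forall (b b' : bool) (i i' : nat), (1 <= i <= m)%nat -> (1 <= i' <= m)%nat ->
     (b, i) <> (b', i') -> forall p, ~ (Ccurve m k l b i p /\ Ccurve m k l b' i' p)) /\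
  (* the limit cycles *)
  exists eps0, 0 < eps0 /\
  exists (U : bool -> nat -> pt -> Prop) (O : bool -> nat -> R -> pt -> Prop),
    (forall (b : bool) (i : nat), (1 <= i <= m)%nat ->
       tubular_nbhd m k l b i (U b i) /\
       (forall eps, 0 < eps <= eps0 ->
          limit_cycle m k l eps (O b i eps) /\ subset (O b i eps) (U b i) /\
          (forall O', limit_cycle m k l eps O' -> subset O' (U b i) ->
                      same_set O' (O b i eps)) /\
          (if b then hyp_repelling m k l eps (O b i eps)
           else hyp_attracting m k l eps (O b i eps)) /\
          torus_knot k l (O b i eps)) /\
       (if b then canard m k l (O b i) else ~ canard m k l (O b i)) /\
       hausdorff_conv (O b i) (Ccurve m k l b i)) /\
    (forall eps, 0 < eps <= eps0 -> forall tau : pt,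
       (forall (b : bool) (i : nat), (1 <= i <= m)%nat -> ~ O b i eps tau) ->
       (exists j, (1 <= j <= m)%nat /\ same_set (alpha_limit m k l eps tau) (O true j eps)) /\
       (exists j, (1 <= j <= m)%nat /\ same_set (omega_limit m k l eps tau) (O false j eps))).
Proof.
intros Hm Hk Hg. split; [|split].
- intros b i _. split.
  + exact (torus_knot_line k l (level m b i) Hk Hg).
  + intros p. now apply Ccurve_normal.
- intros b b' i i' Hi Hi' Hne p. now apply Ccurve_disjoint.
- exists (eps_bound k l). split; [now apply eps_bound_pos|].
  exists (band m k l), (cycle m k l). split.
  + intros b i _. split; [|split; [|split]].
    * now apply band_tubular.
    * intros eps Heps. assert (H := regime_slow_angle m k l eps Hm Hk Heps).
      split; [|split; [|split; [|split]]].
      -- now apply cycle_limit_cycle.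
      -- now apply cycle_in_band.
      -- intros O' [HO' _]. now apply periodic_orbit_in_band.
      -- assert (Hp : cycle m k l b i eps (line_base k (cycle_level m k l b i eps)))
           by now apply line_base_line.
         destruct (cycle_theta _ _ _ _ _ _ _ Hm Hp) as [n Hn].
         destruct b; eauto using hyp_repelling_cycle, hyp_attracting_cycle.
      -- now apply torus_knot_line.
    * destruct b; [now apply repelling_cycle_canard | now apply attracting_cycle_not_canard].
    * now apply cycle_hausdorff.
  + intros eps Heps tau Htau. assert (H := regime_slow_angle m k l eps Hm Hk Heps).
    assert (Hs : sin (theta m k l tau) <> sin (slow_angle k l eps)).
    { intros Hs. destruct (equilibrium_on_cycle m k l eps tau Hm Hs) as [b [i [Hi Hc]]].
      exact (Htau b i Hi Hc). }
    split; [now apply alpha_limit_cycle | now apply omega_limit_cycle].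
Qed.
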